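(* Let $G^{\sigma}$ be a finite oriented graph of order $n$ without loops and multiple arcs, with underlying graph $G$. Then $G^{\sigma}$ is lower-optimal, i.e. $sr(G^{\sigma})=r(G)-2d(G)$, if and only if the following conditions all hold: (1) The cycles (if any) of $G^{\sigma}$ are pairwise vertex-disjoint, i.e. distinct cycles of $G$ have no common vertices. (2) Each cycle $C_q^{\sigma}$ of $G^{\sigma}$ (of order $q$) is evenly-oriented and satisfies $q\equiv 2 \pmod 4$. (3) A (possibly empty) finite series of $\delta$-transformations switches $G$ to a subgraph $G_0$ which is the disjoint union of $d(G)$ cycles together with some (possibly no) isolated vertices.
   Context: All graphs are finite and simple (no loops, no multiple edges), not necessarily connected. For a graph $G$ with vertices $v_1,\dots,v_n$, the adjacency matrix $A(G)=(a_{ij})$ has $a_{ij}=1$ if $v_iv_j\in E(G)$ and $a_{ij}=0$ otherwise; $r(G)$ denotes the rank of $A(G)$ (over $\mathbb{R}$). An oriented graph $G^{\sigma}$ is obtained from a simple graph $G$ (its underlying graph) by assigning to each edge of $G$ a direction. Its skew-adjacency matrix $S(G^{\sigma})=(s_{ij})$ has $s_{ij}=-s_{ji}=1$ if $(v_i,v_j)$ is an arc of $G^{\sigma}$, and $s_{ij}=s_{ji}=0$ if $v_i,v_j$ are not adjacent; the skew-rank $sr(G^{\sigma})$ is the rank of $S(G^{\sigma})$. The dimension of the cycle space of $G$ is $d(G)=|E(G)|-|V(G)|+\theta(G)$, where $\theta(G)$ is the number of connected components of $G$. Cycles of $G^{\sigma}$ are the cycles of the underlying graph $G$ with the inherited orientation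 (they need not be directed cycles). For a cycle $C_q^{\sigma}=v_1v_2\cdots v_qv_1$ with $q$ even, its sign is the sign of $\prod_{i=1}^{q}s_{v_iv_{i+1}}$ (with $v_{q+1}=v_1$), and $C_q^{\sigma}$ is called evenly-oriented if its sign is positive and oddly-oriented if its sign is negative. A pendant vertex is a vertex of degree $1$. For a graph with at least one pendant vertex, a $\delta$-transformation is the operation of deleting a pendant vertex together with its (unique) adjacent vertex (and all incident edges). The graph with no vertices is allowed as a result; it has rank $0$ and $d=0$. *)

(* Defs.v *)
From HB Require Import structures.
From mathcomp Require Import all_boot all_order all_algebra.
From mathcomp Require Import reals.

Set Implicit Arguments.
Unset Strict Implicit.
Unset Printing Implicit Defensive.

Import Order.TTheory GRing.Theory Num.Theory.

Local Open Scope ring_scope.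

Record sgraph (T : finType) := SGraph {
  adj :> rel T;
  adj_sym : symmetric adj;
  adj_irr : irreflexive adj }.

Record ograph (T : finType) := OGraph {
  arc :> rel T;
  arc_asym : forall x y : T, arc x y -> ~~ arc y x }.

Section Underlying.
Variables (T : finType) (D : ograph T).

Definition underlying_rel : rel T := fun x y => arc D x y || arc D y x.

Lemma underlying_sym : symmetric underlying_rel.
Proof. by move=> x y; rewrite /underlying_rel orbC. Qed.

Lemma underlying_irr : irreflexive underlying_rel.
Proof.
move=> x; rewrite /underlying_rel orbb.
by apply/negP => h; have := arc_asym h; rewrite h.
Qed.

Definition underlying : sgraph T := SGraph underlying_sym underlying_irr.

End Underlying.

Section Graph.
Variables (T : finType) (G : sgraph T).

Definition edges : {set {set T}} :=
  [set [set p.1; p.2] | p : T * T & adj G p.1 p.2].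

(* In int, so that the subtraction is not truncated. *)
Definition cycle_space_dim : int :=
  #|edges|%:Z - #|T|%:Z + (n_comp (adj G) predT)%:Z.

(* A cycle v_1 v_2 ... v_q v_1 is given by the list of its vertices. Lists that
   differ by a rotation or a reversal describe the same cycle, so cycles are
   compared through their edge sets. *)
Definition is_cycle (c : seq T) : bool := (2 < size c)%N && ucycleb (adj G) c.

Definition cycle_edges (c : seq T) : {set {set T}} :=
  [set [set x; next c x] | x in c].

Definition cycles_vertex_disjoint : Prop :=
  forall c1 c2 : seq T, is_cycle c1 -> is_cycle c2 ->
    cycle_edges c1 <> cycle_edges c2 -> [disjoint c1 & c2].

(* Subgraphs obtained by deleting vertices are induced, so they are given by
   the set S of the remaining vertices. *)
Definition degree_in (S : {set T}) (x : T) : nat :=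
  #|[set y in S | adj G x y]|.

Inductive delta_reachable : {set T} -> Prop :=
| delta_start : delta_reachable [set: T]
| delta_step (S : {set T}) (v w : T) :
    delta_reachable S -> v \in S -> w \in S ->
    degree_in S v = 1%N -> adj G v w ->
    delta_reachable (S :\: [set v; w]).

(* The vertices of S lying on none of the cycles in cs are isolated in the
   subgraph induced by S, because its edges are exactly those of the cycles. *)
Definition cycles_and_isolated (S : {set T}) (k : nat) : Prop :=
  exists cs : seq (seq T),
    [/\ size cs = k,
        forall c, c \in cs -> is_cycle c /\ {subset c <= S},
        uniq (flatten cs) &
        {in S &, forall x y,
           adj G x y = has (fun c => [set x; y] \in cycle_edges c) cs}].

End Graph.

Section Matrices.
Variables (R : realType) (T : finType).

Definition adjmx (G : sgraph T) : 'M[R]_#|T| :=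
  \matrix_(i, j) (adj G (enum_val i) (enum_val j))%:R.

Definition graph_rank (G : sgraph T) : nat := \rank (adjmx G).

Definition skew_entry (D : ograph T) (x y : T) : R :=
  if arc D x y then 1 else if arc D y x then -1 else 0.

Definition skewmx (D : ograph T) : 'M[R]_#|T| :=
  \matrix_(i, j) skew_entry D (enum_val i) (enum_val j).

Definition skew_rank (D : ograph T) : nat := \rank (skewmx D).

Definition evenly_oriented (D : ograph T) (c : seq T) : Prop :=
  ~~ odd (size c) /\ 0 < \prod_(x <- c) skew_entry D x (next c x).

Definition lower_optimal (D : ograph T) : Prop :=
  (skew_rank D)%:Z =
    (graph_rank (underlying D))%:Z - 2%:Z * cycle_space_dim (underlying D).

End Matrices.

(* Main.v *)
Require Import Defs.
From HB Require Import structures.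
From mathcomp Require Import all_boot all_order all_algebra.
From mathcomp Require Import reals zify ring.

Set Implicit Arguments.
Unset Strict Implicit.
Unset Printing Implicit Defensive.

Import Order.TTheory GRing.Theory Num.Theory.

Local Open Scope ring_scope.

(** Give the edges of a graph G two arbitrary nonzero weightings a and b over a
   field, and let rk a S and rk b S be the ranks of the weighted adjacency
   matrices of the subgraph induced by S; the adjacency and the skew-adjacency
   matrices are two such weightings. The inequality
     rk a S <= rk b S + 2 d(S)
   (lemma rank_gap) holds by induction: a vertex of a cycle can be deleted, which
   lowers d by at least 1 and a rank by at most 2, and a delta-transformation
   lowers both ranks by exactly 2 without raising d; one of the two is available
   as long as there is an edge. The theorem is about S being tight, that is,
   attaining equality.

   Reading the induction backwards, both kinds of deletion preserve tightness;
   d drops by exactly 1 when a vertex of a cycle is deleted, and is unchanged by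
   a delta-transformation. Hence an edge at a vertex of a cycle that is not an
   edge of this cycle must be a bridge (tight_bridge): otherwise deleting the
   vertex would break two independent cycles. So the cycles are disjoint and have
   no chords, and no delta-transformation touches a cycle.

   Apply delta-transformations until no pendant vertex is left. If an edge
   remains, then some cycle is left by at most one edge (pendant_cycle). If no
   edge leaves it, it splits off, the gap between its own two ranks must be 2, and
   one goes on with the rest. An edge xz leaving it is impossible
   (no_pendant_cycle). Indeed, deleting one vertex of the cycle and applying
   delta-transformations to what is left of it yields, depending on the deleted
   vertex, either the rest H of the graph, or H with x attached to z as a pendant
   vertex, so both are tight. Tightness of the second says that z is on no cycle
   and that H without z is tight; if z has at least 2 neighbours in H, then H has
   no pendant vertex and is by induction made of cycles and isolated vertices,
   which is absurd; otherwise z itself hangs in H from its only neighbour, and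
   the argument repeats with a smaller graph (no_hanging_edge). The final graph is
   thus a disjoint union of d(G) cycles and isolated vertices. Conversely,
   delta-transformations preserve the difference of the two ranks, which is
   additive over the cycles of the final graph.

   It remains to compute with a single cycle. Going round an even cycle multiplies
   the entries of a kernel vector by a sign, the holonomy: the matrix is
   invertible when it is -1 and has corank 2 when it is 1. The holonomy is
   (-1)^(q/2) for the adjacency matrix and the sign of the cycle for the skew
   one, so a gap of 2 means q = 2 modulo 4 and evenly oriented; the gap of an odd
   cycle is at most 1. *)

(** * Dimension of the cycle space under deletion of edges *)

Section CycleDimension.
Variable T : finType.
Implicit Types (e : rel T) (a b x y : T) (c : seq T).

Lemma eq_set2 x y a b :
  ([set x; y] == [set a; b]) = (x == a) && (y == b) || (x == b) && (y == a).
Proof.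
apply/eqP/orP; last first.
  by case=> /andP[/eqP-> /eqP->] //; rewrite setUC.
move=> E; have/setP Ei := E.
have := Ei x; have := Ei y; have := Ei a; have := Ei b.
rewrite !inE !eqxx !orbT /= (eq_sym b) (eq_sym b y) (eq_sym a) (eq_sym a y).
by do 4![case: eqP => ?]; rewrite ?orbT ?orbF; subst; auto.
Qed.

Definition rel_edges e : {set {set T}} := [set [set p.1; p.2] | p : T * T & e p.1 p.2].

(** This is also the dimension for an induced subgraph when e keeps only the
   edges of that subgraph: the deleted vertices become isolated and contribute
   equally to both the number of vertices and the number of components. *)
Definition rel_dim e : int := #|rel_edges e|%:Z - #|T|%:Z + (n_comp e predT)%:Z.

Definition del_edge e a b : rel T :=
  fun x y => e x y && ([set x; y] != [set a; b]).

Lemma del_edge_sym e a b : symmetric e -> symmetric (del_edge e a b).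
Proof. by move=> es x y; rewrite /del_edge es [[set x; y]]setUC. Qed.

Lemma in_rel_edges e x y : symmetric e -> ([set x; y] \in rel_edges e) = e x y.
Proof.
move=> es; apply/imsetP/idP => [[[u v]]|exy]; last by exists (x, y); rewrite ?inE.
rewrite inE /= => euv /eqP; rewrite eq_set2.
by case/orP => /andP[/eqP-> /eqP->] //; rewrite es.
Qed.

Lemma card_rel_edges_del e a b : symmetric e -> e a b ->
  #|rel_edges e| = #|rel_edges (del_edge e a b)|.+1.
Proof.
move=> es eab; rewrite (cardsD1 [set a; b]) in_rel_edges // eab add1n; congr _.+1.
apply: eq_card => f; rewrite !inE; apply/andP/imsetP.
  case=> fN /imsetP[[u v]]; rewrite inE /= => euv fE.
  by exists (u, v) => //; rewrite inE /del_edge /= euv -fE.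
case=> -[u v]; rewrite inE /= => /andP[euv N] ->; split=> //.
by rewrite in_rel_edges.
Qed.

Lemma eq_rel_dim e e' : e =2 e' -> rel_dim e = rel_dim e'.
Proof.
move=> ee; rewrite /rel_dim (eq_n_comp (eq_connect ee)).
congr (_%:Z - _ + _); apply: eq_card => f; apply/imsetP/imsetP => -[p];
rewrite inE => ep ->; exists p => //; by rewrite inE ?ee // -ee.
Qed.

(** When ab is a bridge, the two components of a and b in the graph without ab form
   a set closed for both relations, outside of which the relations agree. *)
Lemma n_comp_del_edge e a b : symmetric e -> e a b ->
  (n_comp (del_edge e a b) predT =
   n_comp e predT + ~~ connect (del_edge e a b) a b)%N.
Proof.
move=> es eab; set e' := del_edge e a b.
have es' : symmetric e' by apply: del_edge_sym.
have cs := sym_connect_sym es; have cs' := sym_connect_sym es'.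
have sub : subrel (connect e') (connect e).
  by apply: connect_sub => x y /andP[exy _]; apply: connect1.
case: (boolP (connect e' a b)) => [cab|ncab] /=.
  rewrite addn0; apply: eq_n_comp => x y.
  apply/idP/idP; first exact: sub.
  apply: connect_sub x y => x y exy.
  case: (boolP ([set x; y] == [set a; b])) => [|N].
    by rewrite eq_set2 => /orP[]/andP[/eqP-> /eqP->] //; rewrite cs'.
  by apply: connect1; rewrite /e' /del_edge exy.
pose A := closure e' (pred2 a b).
have cA' : closed e' A by apply: closure_closed.
have aA : a \in A by apply: mem_closure; rewrite inE eqxx.
have bA : b \in A by apply: mem_closure; rewrite inE eqxx orbT.
have cA : closed e A.
  move=> x y exy; case: (boolP ([set x; y] == [set a; b])) => [|N].
    by rewrite eq_set2 => /orP[]/andP[/eqP-> /eqP->]; rewrite aA bA.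
  by apply: cA'; rewrite /e' /del_edge exy.
have AE : A =i closure e (pred2 a b).
  move=> x; apply/idP/idP.
    case/pred0Pn=> y /andP[/= cxy yab].
    by apply/pred0Pn; exists y; rewrite /= yab andbT; apply: sub.
  case/pred0Pn=> y /andP[/= cxy yab].
  rewrite (closed_connect cA cxy); by case/pred2P: yab => ->.
rewrite (n_compC A) [in RHS](n_compC A) (eq_n_comp_r (e := e) AE).
rewrite !n_comp_closure2 // ncab (connect1 eab) /=.
suff -> : n_comp e' [predC A] = n_comp e [predC A] by lia.
apply: eq_card => x; rewrite !inE; case: (boolP (x \in A)); rewrite ?andbF // => xA.
rewrite !andbT; congr (_ == _); rewrite /root; congr odflt; apply: eq_pick => y.
apply/idP/idP; first exact: sub.
case/connectP=> p pp ->; elim: p x xA pp => //= z p IH x xA /andP[exz pp].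
have zA : z \notin A by rewrite -(cA _ _ exz).
apply: connect_trans (IH _ zA pp); apply: connect1.
rewrite /e' /del_edge exz /= eq_set2; apply/negP.
by case/orP => /andP[/eqP Ex _]; move: xA; rewrite Ex ?aA ?bA.
Qed.

Lemma rel_dim_del_edge e a b : symmetric e -> e a b ->
  rel_dim (del_edge e a b) = rel_dim e - (connect (del_edge e a b) a b : nat)%:Z.
Proof.
move=> es eab; rewrite /rel_dim (card_rel_edges_del es eab) n_comp_del_edge //.
by case: connect => /=; lia.
Qed.

Lemma rel_dim_mono e e' : symmetric e -> symmetric e' -> subrel e' e ->
  rel_dim e' <= rel_dim e.
Proof.
have [n] := ubnP #|rel_edges e|; elim: n e => // n IH e ltn es es' sub.
case: (boolP [exists a, exists b, e a b && ~~ e' a b]); last first.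
  move=> /existsPn N; rewrite (eq_rel_dim (e := e) (e' := e')) // => x y.
  apply/idP/idP => [exy|]; last exact: sub.
  by move/existsPn: (N x) => /(_ y); rewrite exy negbK.
case/existsP=> a /existsP[b /andP[eab neab]].
apply: le_trans (_ : rel_dim (del_edge e a b) <= _); last first.
  by rewrite rel_dim_del_edge //; lia.
apply: IH => //; first by move: ltn; rewrite (card_rel_edges_del es eab).
  exact: del_edge_sym.
move=> x y exy; rewrite /del_edge (sub _ _ exy) /= eq_set2; apply/negP.
by case/orP => /andP[/eqP Ex /eqP Ey]; move: exy neab; rewrite Ex Ey ?(es' b) => ->.
Qed.

Lemma rel_dim0 e : e =2 (fun _ _ => false) -> rel_dim e = 0.
Proof.
move=> e0; have E : #|rel_edges e| = 0%N.
  by apply: eq_card0 => f; apply/imsetP => -[p]; rewrite inE e0.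
rewrite /rel_dim E.
have -> : n_comp e predT = #|T|; last by lia.
apply: eq_card => x; rewrite !inE andbT.
have cs : connect_sym e by apply: sym_connect_sym => u v; rewrite !e0.
have /connectP[[|y p]] := connect_root e x; last by rewrite /= e0.
by move=> _ /= E'; apply/eqP.
Qed.

Definition rel_cycle e c := (2 < size c)%N && ucycleb e c.

(** Going round the cycle the other way joins x to its successor. *)
Lemma connect_next_del_edge e c x : symmetric e -> rel_cycle e c -> x \in c ->
  connect (del_edge e x (next c x)) x (next c x).
Proof.
move=> es /andP[sz /andP[cy un]] xc.
case/rot_to: (xc) => i p cE.
have cy' : cycle e (x :: p) by rewrite -cE rot_cycle.
have un' : uniq (x :: p) by rewrite -cE rot_uniq.
have sz' : (2 < size (x :: p))%N by rewrite -cE size_rot.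
rewrite -(next_rot i un) cE.
case: p cy' un' sz' {cE} => // y [|z p] // cy' un' _ /=; rewrite eqxx.
set e' := del_edge e x y.
have cs' := sym_connect_sym (del_edge_sym x y es).
rewrite cs'; apply/connectP; exists (rcons (z :: p) x); last by rewrite last_rcons.
move: cy' => /= /and3P[exy eyz pz].
move: un'; rewrite /= !inE !negb_or => /andP[/and3P[xy xz xp]] /andP[/andP[yz yp] /andP[zp up]].
rewrite /e' /del_edge eyz /= eq_set2 (eq_sym y x) (negbTE xy) (eq_sym z x) (negbTE xz) andbF /=.
elim: p z pz xz xp yz yp {eyz zp up} => [|t p IH] z /=.
  by rewrite !andbT eq_set2 => -> xz _ yz _; rewrite (eq_sym z) (negbTE xz) (eq_sym z) (negbTE yz).
rewrite !inE !negb_or => /andP[ezt pt] xz /andP[xt xp] yz /andP[yt yp].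
rewrite eq_set2 ezt (eq_sym z x) (negbTE xz) (eq_sym z y) (negbTE yz) /=.
exact: IH.
Qed.

(** Deleting one missing edge of the cycle does not disconnect anything, so
   that the dimension drops by 1; the other deletions cannot raise it. *)
Lemma rel_dim_cycle e e' c x : symmetric e -> symmetric e' -> subrel e' e ->
  rel_cycle e c -> x \in c -> ~~ e' x (next c x) -> rel_dim e' <= rel_dim e - 1.
Proof.
move=> es es' sub cc xc N; have cn := connect_next_del_edge es cc xc.
have exn : e x (next c x) by case/andP: cc => _ /andP[cy _]; apply: next_cycle.
apply: le_trans (_ : rel_dim (del_edge e x (next c x)) <= _); last first.
  by rewrite rel_dim_del_edge // cn.
apply: rel_dim_mono => //; first exact: del_edge_sym.
move=> u v euv; rewrite /del_edge (sub _ _ euv) /= eq_set2; apply/negP.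
by case/orP => /andP[/eqP E1 /eqP E2]; move: euv N; rewrite E1 E2 ?(es' (next c x)) => ->.
Qed.

End CycleDimension.

(** * Ranks of weighted adjacency matrices *)

Section WeightedRank.
Variables (F : fieldType) (T : finType).
Implicit Types (S A B : {set T}) (w : T -> T -> F).

Definition proj_mx S : 'M[F]_#|T| := diag_mx (\row_i (enum_val i \in S)%:R).

(** The rows and columns outside of S are filled with zeros, rather than removed,
   so that all the induced subgraphs have matrices of the same type. *)
Definition wmx w S : 'M[F]_#|T| :=
  \matrix_(i, j) if (enum_val i \in S) && (enum_val j \in S)
                 then w (enum_val i) (enum_val j) else 0.

Definition rk w S : nat := \rank (wmx w S).

Lemma proj_mulE S (M : 'M[F]_#|T|) i j :
  (proj_mx S *m M) i j = if enum_val i \in S then M i j else 0.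
Proof. by rewrite /proj_mx mul_diag_mx !mxE; case: ifP; rewrite ?mul1r ?mul0r. Qed.

Lemma mul_projE S m (M : 'M[F]_(m, #|T|)) i j :
  (M *m proj_mx S) i j = if enum_val j \in S then M i j else 0.
Proof. by rewrite /proj_mx mul_mx_diag !mxE; case: ifP; rewrite ?mulr1 ?mulr0. Qed.

Lemma rank_proj_set1 x : (\rank (proj_mx [set x]) <= 1)%N.
Proof.
suff -> : proj_mx [set x] = delta_mx (enum_rank x) (enum_rank x).
  by rewrite mxrank_delta.
apply/matrixP => i j; rewrite !mxE inE.
have E k : (k == enum_rank x) = (enum_val k == x).
  by rewrite -(inj_eq enum_val_inj) enum_rankK.
rewrite !E; case: (eqVneq i j) => [<-|ij]; first by rewrite andbb mulr1n.
rewrite mulr0n; case: eqP => //= ix; case: eqP => // jx.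
by case/eqP: ij; apply: enum_val_inj; rewrite ix jx.
Qed.

Lemma rank_proj_mx S : (\rank (proj_mx S) <= #|S|)%N.
Proof.
have [n] := ubnP #|S|; elim: n S => // n IH S ltn.
have [->|[x xS]] := set_0Vmem S.
  suff -> : proj_mx set0 = 0 by rewrite mxrank0.
  by apply/matrixP => i j; rewrite !mxE inE mul0rn.
have -> : proj_mx S = proj_mx (S :\ x) + proj_mx [set x].
  apply/matrixP => i j; rewrite !mxE !inE -mulrnDl; congr (_ *+ _).
  by case: eqP => [->|]; rewrite ?xS ?add0r ?addr0.
apply: leq_trans (mxrank_add _ _) _; rewrite (cardsD1 x S) xS add1n -addn1 leq_add //.
  by apply: IH; move: ltn; rewrite (cardsD1 x S) xS.
exact: rank_proj_set1.
Qed.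

Lemma rk_subset w A S : A \subset S -> (rk w A <= rk w S)%N.
Proof.
move=> /subsetP sAS.
have -> : rk w A = \rank (proj_mx A *m wmx w S *m proj_mx A).
  congr (\rank _); apply/matrixP => i j; rewrite mul_projE proj_mulE !mxE.
  case iA: (enum_val i \in A); case jA: (enum_val j \in A) => //=.
  by rewrite (sAS _ iA) (sAS _ jA).
by apply: leq_trans (mxrankM_maxl _ _) (mxrankM_maxr _ _).
Qed.

Lemma rk_leq_card w S : (rk w S <= #|S|)%N.
Proof.
apply: leq_trans (rank_proj_mx S); rewrite /rk.
suff -> : wmx w S = proj_mx S *m wmx w S by apply: mxrankM_maxl.
by apply/matrixP => i j; rewrite proj_mulE !mxE; case: (enum_val i \in S).
Qed.

Lemma rk_eq_edges w S S' :
  (forall x y, (if (x \in S) && (y \in S) then w x y else 0) =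
               (if (x \in S') && (y \in S') then w x y else 0)) ->
  rk w S = rk w S'.
Proof. by move=> E; congr (\rank _); apply/matrixP => i j; rewrite !mxE E. Qed.

Lemma rk_setD1 w S x : (rk w S <= rk w (S :\ x) + 2)%N.
Proof.
pose P := proj_mx [set x]; pose P' := proj_mx (~: [set x]).
rewrite /rk; have -> : wmx w S = wmx w (S :\ x) + P *m wmx w S + P' *m wmx w S *m P.
  apply/matrixP => i j; rewrite !(mul_projE, proj_mulE, mxE) !inE.
  by case: (enum_val i == x); case: (enum_val j == x); rewrite /= ?andbF ?addr0 ?add0r.
rewrite addn2 -addn1 -[X in (_ <= X + 1)%N]addn1.
apply: leq_trans (mxrank_add _ _) (leq_add _ _).
  apply: leq_trans (mxrank_add _ _) (leq_add _ _) => //.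
  exact: leq_trans (mxrankM_maxl _ _) (rank_proj_set1 x).
exact: leq_trans (mxrankM_maxr _ _) (rank_proj_set1 x).
Qed.

Lemma rank_lt_row m n p (U : 'M[F]_(m, n)) (M : 'M[F]_(p, n)) (r : 'rV_n) j :
  (U <= M)%MS -> (r <= M)%MS -> r 0 j != 0 -> (forall i, U i j = 0) ->
  (\rank U < \rank M)%N.
Proof.
move=> UM rM rj Uj; apply: rank_ltmx; rewrite /ltmx UM /=.
apply/negP => MU; have /submxP[D rE] := submx_trans rM MU.
by case/eqP: rj; rewrite rE mxE big1 // => i _; rewrite Uj mulr0.
Qed.

(** For the lower bound: up to a factor, the row of the pendant vertex u is the
   unit vector at v, with which column v of the other rows can be cleared;
   row v is then independent from all of these because of its entry at u. *)
Lemma rk_pendant w S u v : u \in S -> v \in S -> u != v ->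
  w u v != 0 -> w v u != 0 ->
  (forall x, x \in S -> x != v -> w u x = 0 /\ w x u = 0) ->
  rk w S = (rk w (S :\: [set u; v])).+2.
Proof.
move=> uS vS uv wuv wvu pen; apply/eqP; rewrite eqn_leq; apply/andP; split.
  have := rk_setD1 w S v; rewrite addn2.
  suff -> : rk w (S :\ v) = rk w (S :\: [set u; v]) by [].
  apply: rk_eq_edges => x y; rewrite !inE.
  case: (eqVneq x u) => [->|_] /=.
    by case: ifP => // /andP[_ /andP[yv yS]]; case: (pen y).
  case: (eqVneq y u) => [->|_] //=; rewrite andbF.
  by case: ifP => // /andP[/andP[xv xS] _]; case: (pen x).
set M' := wmx w (S :\: [set u; v]); set M := wmx w S.
pose U := proj_mx (~: [set v]) *m M.
have rowU x i : enum_val i = x -> x != v -> row i U = row i M.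
  move=> ix xv; apply/rowP => k; rewrite mxE proj_mulE [in RHS]mxE.
  by rewrite inE ix inE xv.
have rowu : row (enum_rank u) M = w u v *: delta_mx 0 (enum_rank v).
  apply/rowP => k; rewrite !mxE eqxx /= enum_rankK uS /=.
  rewrite -(inj_eq enum_val_inj) enum_rankK.
  case: ifP => [kS|]; case: eqP => [->|/eqP kv]; rewrite ?mulr1 ?mulr0 ?vS //.
  by case: (pen _ kS kv).
have rowuU : (row (enum_rank u) M <= U)%MS.
  by rewrite -(rowU u) ?row_sub // enum_rankK.
have M'U : (M' <= U)%MS.
  apply/row_subP => i; case: (boolP (enum_val i \in S :\: [set u; v])) => iS; last first.
    suff -> : row i M' = 0 by apply: sub0mx.
    by apply/rowP => k; rewrite !mxE (negbTE iS).
  have [iu iv iSS] : [/\ enum_val i != u, enum_val i != v & enum_val i \in S].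
    by move: iS; rewrite !inE negb_or => /andP[/andP[]].
  have -> : row i M' = row i U - (w (enum_val i) v / w u v) *: row (enum_rank u) M.
    rewrite (rowU _ i erefl iv) rowu scalerA divfK //.
    apply/rowP => k; rewrite !mxE iS iSS !eqxx /= -(inj_eq enum_val_inj) enum_rankK !inE.
    case: (eqVneq (enum_val k) v) => [->|kv]; first by rewrite vS orbT mulr1 subrr.
    rewrite mulr0 subr0 orbF; case: (eqVneq (enum_val k) u) => [ku|ku] //=.
    by rewrite ku uS; case: (pen _ iSS iv).
  by rewrite addmx_sub ?row_sub // eqmx_opp scalemx_sub.
have lt1 : (\rank M' < \rank U)%N.
  apply: (rank_lt_row M'U rowuU (j := enum_rank v)).
    by rewrite rowu !mxE !eqxx mulr1.
  by move=> i; rewrite !mxE enum_rankK !inE eqxx orbT andbF.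
apply: leq_ltn_trans lt1 _.
apply: (rank_lt_row (submxMl _ _) (row_sub (enum_rank v) M) (j := enum_rank u)).
  by rewrite !mxE !enum_rankK uS vS.
move=> i; rewrite proj_mulE !mxE enum_rankK uS andbT !inE.
by case: ifP => // iv; case: ifP => // iS; case: (pen _ iS iv).
Qed.

Lemma rank_add_disjoint S1 S2 (A B : 'M[F]_#|T|) : [disjoint S1 & S2] ->
  A = proj_mx S1 *m A *m proj_mx S1 -> B = proj_mx S2 *m B *m proj_mx S2 ->
  \rank (A + B)%R = (\rank A + \rank B)%N.
Proof.
move=> dis EA EB.
have P0 (U V : {set T}) : [disjoint U & V] -> proj_mx U *m proj_mx V = 0 :> 'M[F]_#|T|.
  move=> dUV; apply/matrixP => i j; rewrite proj_mulE !mxE.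
  case: ifP => // iU; case: eqP => //= _.
  by rewrite (disjointFr dUV iU).
have P1 (U : {set T}) : proj_mx U *m proj_mx U = proj_mx U.
  by apply/matrixP => i j; rewrite proj_mulE !mxE; case: (enum_val i \in U); rewrite ?mul0rn.
have dis' : [disjoint S2 & S1] by rewrite disjoint_sym.
apply/eqP; rewrite eqn_leq mxrank_add /=.
have cap0 : (A :&: B = 0)%MS.
  apply/eqP; rewrite -submx0; apply/rV_subP => v; rewrite sub_capmx.
  case/andP=> /submxP[X vX] /submxP[Y vY].
  have vv : v = v *m proj_mx S1 by rewrite vX EA -!mulmxA P1.
  by rewrite vv vY EB -!mulmxA P0 // !mulmx0 sub0mx.
rewrite -(mxrank_disjoint_sum cap0) mxrankS // addsmx_sub; apply/andP; split.
  apply/submxP; exists (proj_mx S1).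
  rewrite mulmxDr [in X in _ + X]EB !mulmxA P0 // !mul0mx addr0.
  by rewrite EA !mulmxA P1.
apply/submxP; exists (proj_mx S2).
rewrite mulmxDr [in X in X + _]EA !mulmxA P0 // !mul0mx add0r.
by rewrite EB !mulmxA P1.
Qed.

Lemma rk_disjoint w S A : A \subset S ->
  (forall x y, x \in A -> y \in S :\: A -> w x y = 0 /\ w y x = 0) ->
  rk w S = (rk w A + rk w (S :\: A))%N.
Proof.
move=> sAS noE.
have PP B : wmx w B = proj_mx B *m wmx w B *m proj_mx B.
  apply/matrixP => i j; rewrite mul_projE proj_mulE !mxE.
  by case: (enum_val i \in B); case: (enum_val j \in B).
rewrite -(@rank_add_disjoint A (S :\: A)) -?PP //; last first.
  by rewrite disjoint_sym disjoints_subset; apply/subsetP => x; rewrite !inE => /andP[].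
congr (\rank _); apply/matrixP => i j; rewrite !mxE !inE.
set x := enum_val i; set y := enum_val j; have sA := subsetP sAS.
have H u v : u \in A -> v \in S -> v \notin A -> w u v = 0 /\ w v u = 0.
  by move=> uA vS vA; apply: noE => //; rewrite inE vA.
case: (boolP (x \in A)) => xA; case: (boolP (y \in A)) => yA /=; rewrite ?addr0 ?add0r //.
- by rewrite !sA.
- by rewrite sA //=; case: ifP => // yS; case: (H x y).
by rewrite (sA _ yA) ?andbT ?andbF /=; case: ifP => // xS; case: (H y x).
Qed.

Lemma rk0 w S : (forall x y, x \in S -> y \in S -> w x y = 0) -> rk w S = 0%N.
Proof.
move=> w0; apply/eqP; rewrite mxrank_eq0; apply/eqP/matrixP => i j.
by rewrite !mxE; case: ifP => // /andP[]; apply: w0.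
Qed.
End WeightedRank.

(** * Induced subgraphs and the rank inequality *)

Section InducedSubgraphs.
Variables (T : finType) (G : sgraph T).
Implicit Types (S A B : {set T}) (c : seq T).

Definition adj_in S : rel T := fun x y => [&& x \in S, y \in S & adj G x y].

Definition dim_in S : int := rel_dim (adj_in S).

Lemma adj_in_sym S : symmetric (adj_in S).
Proof. by move=> x y; rewrite /adj_in adj_sym andbCA. Qed.

Lemma adj_in_sub A S : A \subset S -> subrel (adj_in A) (adj_in S).
Proof.
by move=> /subsetP sAS x y /and3P[xA yA xy]; rewrite /adj_in !sAS.
Qed.

Lemma cycle_inP S c :
  reflect (is_cycle G c /\ {subset c <= S}) (rel_cycle (adj_in S) c).
Proof.
apply: (iffP idP).
  case/andP=> sz /andP[cy un]; split.
    apply/andP; split=> //; apply/andP; split=> //.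
    by apply: sub_cycle cy => x y /and3P[].
  by move=> x xc; case/and3P: (next_cycle cy xc).
case=> /andP[sz /andP[cy un]] sub; apply/andP; split=> //; apply/andP; split=> //.
by apply: (sub_in_cycle _ _ cy (P := mem c)) => [x y /sub xS /sub yS|];
  [rewrite /adj_in xS yS | apply/allP].
Qed.

Lemma dim_in_mono A S : A \subset S -> dim_in A <= dim_in S.
Proof.
by move=> sAS; apply: rel_dim_mono (adj_in_sub sAS); apply: adj_in_sym.
Qed.

Lemma dim_in_cycle A S c x : is_cycle G c -> {subset c <= S} -> x \in c ->
  A \subset S :\ x -> dim_in A <= dim_in S - 1.
Proof.
move=> cc cS xc sAS.
have /(rel_dim_cycle (@adj_in_sym S) (@adj_in_sym A)) : rel_cycle (adj_in S) c.
  exact/cycle_inP.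
apply; last 2 first.
- exact: xc.
- by apply/negP => /and3P[/(subsetP sAS)]; rewrite !inE eqxx.
by apply: adj_in_sub; apply: subset_trans sAS (subD1set _ _).
Qed.

Lemma dim_in_edgeless S : {in S &, forall x y, ~~ adj G x y} -> dim_in S = 0.
Proof.
move=> noE; apply: rel_dim0 => x y; apply/negP => /and3P[xS yS].
exact/negP/noE.
Qed.

Lemma pendant_nbr S v w x : degree_in G S v = 1%N -> w \in S -> adj G v w ->
  x \in S -> adj G v x -> x = w.
Proof.
move=> /eqP/cards1P[y yE] wS vw xS vx.
have /set1P -> : x \in [set y] by rewrite -yE inE xS.
by have /set1P -> : w \in [set y] by rewrite -yE inE wS.
Qed.

Lemma degree_in_eq1 S v w : w \in S -> adj G v w ->
  (forall x, x \in S -> adj G v x -> x = w) -> degree_in G S v = 1%N.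
Proof.
move=> wS vw uniq_w; apply/eqP/cards1P; exists w; apply/setP => x.
rewrite !inE; apply/andP/eqP => [[xS vx]|->] //; exact: uniq_w.
Qed.

Lemma other_nbr S v w : degree_in G S v != 1%N -> w \in S -> adj G v w ->
  exists x, [/\ x \in S, adj G v x & x != w].
Proof.
move=> dv wS vw.
case: (pickP [pred x in S | adj G v x & x != w]) => [x /and3P[xS vx xw]|N].
  by exists x.
case/eqP: dv; apply: (degree_in_eq1 wS vw) => x xS vx; apply/eqP.
by move: (N x); rewrite /= xS vx /= => /negbFE.
Qed.

Lemma degree1_nbr S x : degree_in G S x = 1%N -> exists2 y, y \in S & adj G x y.
Proof.
move=> dx; have /set0Pn[y] : [set y in S | adj G x y] != set0.
  by rewrite -card_gt0 -/(degree_in G S x) dx.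
by rewrite inE => /andP[yS xy]; exists y.
Qed.

(** A path from u that cannot be extended ends at a vertex that is not pendant, all
   of whose neighbours are on the path. The path is listed from its end. *)
Lemma exists_cycle B u t : u \in B -> t \in B -> adj G u t ->
  (forall y, y \in B -> y != u -> degree_in G B y != 1%N) ->
  exists2 c, is_cycle G c & {subset c <= B}.
Proof.
move=> uB tB ut noP.
suff grow n v v' s : (#|T| < size (v :: v' :: s) + n)%N ->
    path (adj G) v (v' :: s) -> uniq [:: v, v' & s] -> {subset [:: v, v' & s] <= B} ->
    last v' s = u -> exists2 c, is_cycle G c & {subset c <= B}.
  apply: (grow #|T| t u [::]) => //=.
  - by rewrite adj_sym ut.
  - rewrite inE !andbT; apply/eqP => E; move: ut; by rewrite E adj_irr.
  - by move=> y; rewrite !inE => /orP[]/eqP->.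
elim: n v v' s => [|n IH] v v' s ltn pv un sB lu.
  by move: ltn; rewrite addn0 ltnNge -(card_uniqP un) max_card.
have vB : v \in B by apply: sB; rewrite inE eqxx.
have v'B : v' \in B by apply: sB; rewrite !inE eqxx orbT.
have [vv' vs] : v != v' /\ v \notin s.
  by move: un => /= /andP[]; rewrite inE negb_or => /andP[].
have vu : v != u.
  apply: contraNneq (vs) => vE; have := mem_last v' s; rewrite lu -vE inE.
  by rewrite (negbTE vv').
have av : adj G v v' by case/andP: pv.
have [x [xB vx xv']] := other_nbr (noP v vB vu) v'B av.
case: (boolP (x \in [:: v, v' & s])) => [|xN]; last first.
  apply: (IH x v (v' :: s)) => //.
  - by move: ltn; rewrite /= !addSnnS.
  - by move: pv; rewrite /= (adj_sym G x) vx => /andP[-> ->].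
  - by rewrite cons_uniq xN.
  by move=> y; rewrite inE => /predU1P[->|/sB].
rewrite !inE (negbTE xv') /= => /orP[/eqP E|xs].
  by move: vx; rewrite E adj_irr.
case/splitPr: xs pv un sB {ltn lu vs} => s1 s2 pv un sB.
exists [:: v, v' & rcons s1 x]; last first.
  move=> y; rewrite -!rcons_cons mem_rcons => yc; apply: sB.
  move: yc; rewrite !inE mem_cat inE; case/or4P => ->; rewrite ?orbT //.
apply/andP; split; first by rewrite /= size_rcons.
apply/andP; split.
  rewrite /= !rcons_path last_rcons (adj_sym G x) vx andbT.
  by move: pv; rewrite /= cat_path /= => /and3P[-> -> /andP[-> _]].
by move: un; rewrite -cat_rcons -!cat_cons cat_uniq => /andP[].
Qed.

End InducedSubgraphs.

Section RankGap.
Variables (F : fieldType) (T : finType) (G : sgraph T).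
Implicit Types (S A B : {set T}) (c : seq T) (a b w : T -> T -> F).

Definition weighting w := forall x y, (w x y != 0) = adj G x y.

Lemma weighting0 w x y : weighting w -> ~~ adj G x y -> w x y = 0.
Proof. by move=> ww; rewrite -ww negbK => /eqP. Qed.

Lemma rk_delta w S u v : weighting w -> u \in S -> v \in S ->
  degree_in G S u = 1%N -> adj G u v ->
  rk w S = (rk w (S :\: [set u; v]) + 2)%N.
Proof.
move=> ww uS vS du uv; rewrite addn2; apply: rk_pendant; rewrite ?ww // 1?adj_sym //.
  by apply: contraTneq uv => ->; rewrite adj_irr.
move=> x xS xv; have N : ~~ adj G u x.
  by apply: contraNN xv => ux; rewrite (pendant_nbr du vS uv xS ux).
by rewrite !(weighting0 ww) // adj_sym.
Qed.

Lemma rk_edgeless w S : weighting w -> {in S &, forall x y, ~~ adj G x y} ->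
  rk w S = 0%N.
Proof.
by move=> ww noE; apply: rk0 => x y xS yS; apply: weighting0 => //; apply: noE.
Qed.

Lemma pendant_or_cycle S :
  [\/ {in S &, forall x y, ~~ adj G x y},
      exists u v, [/\ u \in S, v \in S, degree_in G S u = 1%N & adj G u v] |
      exists2 c, is_cycle G c & {subset c <= S}].
Proof.
case: (boolP [exists x in S, exists y in S, adj G x y]); last first.
  move=> N; constructor 1 => x y xS yS; apply: contraNN N => xy.
  by apply/exists_inP; exists x => //; apply/exists_inP; exists y.
case/exists_inP=> u uS /exists_inP[t tS ut].
case: (boolP [exists x in S, degree_in G S x == 1%N]).
  case/exists_inP=> x xS /eqP dx; constructor 2.
  by have [y yS xy] := degree1_nbr dx; exists x, y.
move=> /exists_inPn N; constructor 3.
by apply: (exists_cycle uS tS ut) => y yS _; apply: N.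
Qed.

(** Removing a vertex of a cycle lowers the dimension of the cycle space and
   changes either rank by at most 2; removing a pendant vertex and its neighbour
   lowers both ranks by exactly 2. *)
Lemma rank_gap a b S : weighting a -> weighting b ->
  (rk a S)%:Z <= (rk b S)%:Z + 2%:Z * dim_in G S.
Proof.
move=> wa wb; have [n] := ubnP #|S|; elim: n S => // n IH S ltn.
case: (pendant_or_cycle S) => [noE|[u [v [uS vS du uv]]]|[[|x c'] // cc cS]].
- by rewrite !rk_edgeless // dim_in_edgeless.
- rewrite (rk_delta wa uS vS du uv) (rk_delta wb uS vS du uv).
  have lt : (#|S :\: [set u; v]| < #|S|)%N.
    by apply/proper_card/properP; split; [exact: subsetDl | exists u; rewrite ?inE ?eqxx].
  have := IH _ (leq_trans lt ltn).
  have := dim_in_mono G (subsetDl S [set u; v]); lia.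
set c := x :: c' in cc cS.
have xc : x \in c by rewrite inE eqxx.
have lt : (#|S :\ x| < #|S|)%N by rewrite (cardsD1 x S) cS.
have := IH _ (leq_trans lt ltn).
have := dim_in_cycle cc cS xc (subxx _).
have := rk_setD1 a S x; have := rk_subset b (subD1set S x); lia.
Qed.

End RankGap.

(** * Sequences of delta-transformations *)

Section CyclesAndDeltas.
Variables (T : finType) (G : sgraph T).
Implicit Types (S A B : {set T}) (c p q : seq T).

Lemma cycle_edgesP c x y : [set x; y] \in cycle_edges c ->
  (x \in c /\ y = next c x) \/ (y \in c /\ x = next c y).
Proof.
case/imsetP=> z zc /eqP; rewrite eq_set2.
by case/orP=> /andP[/eqP-> /eqP->]; [left|right].
Qed.

Lemma cycle_edges_mem c x y : [set x; y] \in cycle_edges c -> x \in c /\ y \in c.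
Proof. by case/cycle_edgesP=> -[zc ->]; rewrite mem_next. Qed.

Lemma next_cat_uniq (s s' : seq T) x y :
  uniq (s ++ x :: y :: s') -> next (s ++ x :: y :: s') x = y.
Proof.
by move=> un; rewrite -(next_rot (size s) un) rot_size_cat /= eqxx.
Qed.

(** Unlike in delta_reachable, the first transformation comes first, and the
   starting set is arbitrary. *)
Inductive deltas : nat -> {set T} -> {set T} -> Prop :=
| deltas_nil S : deltas 0 S S
| deltas_cons m S S' u v : u \in S -> v \in S -> degree_in G S u = 1%N ->
    adj G u v -> deltas m (S :\: [set u; v]) S' -> deltas m.+1 S S'.

Lemma deltas_reachable m S S' :
  deltas m S S' -> delta_reachable G S -> delta_reachable G S'.
Proof.
elim=> // {}m {}S {}S' u v uS vS du uv _ IH rS; apply: IH.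
exact: delta_step rS uS vS du uv.
Qed.

Lemma deltas_path p S : ~~ odd (size p) -> uniq p -> {subset p <= S} ->
  sorted (adj G) p ->
  (forall p1 x y p2, p = p1 ++ [:: x, y & p2] ->
     forall t, t \in S -> adj G x t -> (t == y) || (t \in p1)) ->
  deltas (size p)./2 S (S :\: [set x in p]).
Proof.
have [n] := ubnP (size p); elim: n p S => // n IH [|x [|y p]] S //=.
  move=> _ _ _ _ _ _; suff -> : S :\: [set x in [::]] = S by constructor.
  by apply/setP => z; rewrite !inE.
rewrite negbK inE negb_or => ltn szp /andP[/andP[xy xp] /andP[yp up]] sS /andP[axy sp] nb.
have xS : x \in S by apply: sS; rewrite inE eqxx.
have yS : y \in S by apply: sS; rewrite !inE eqxx orbT.
have -> : S :\: [set z in [:: x, y & p]] = (S :\: [set x; y]) :\: [set z in p].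
  by apply/setP => z; rewrite !inE !negb_or; do 4![case: (_ \in _) || case: (_ == _)].
apply: (deltas_cons xS yS) => //.
  apply: degree_in_eq1 yS axy _ => t tS xt.
  by have /orP[/eqP|] := nb [::] x y p erefl t tS xt.
apply: IH => //; first by lia.
- move=> z zp; rewrite !inE (sS z) ?inE ?zp ?orbT // andbT negb_or.
  by apply/andP; split; apply/eqP => E; move: zp; rewrite E ?(negbTE xp) ?(negbTE yp).
- by move: sp; case: (p) => //= z p' /andP[].
move=> p1 u v p2 pE t; rewrite !inE negb_or => /andP[/andP[tx ty] tS] ut.
have := nb [:: x, y & p1] u v p2; rewrite pE => /(_ erefl t tS ut).
by rewrite !inE (negbTE tx) (negbTE ty).
Qed.

(** The first vertex of the stretch p has lost its predecessor, last x q, and is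
   therefore pendant; removing it with its successor puts the next vertex of p in
   the same position. *)
Lemma deltas_arc x q p q' S : is_cycle G (x :: q ++ p ++ q') ->
  ~~ odd (size p) -> last x q \notin S -> {subset p <= S} ->
  (forall y t, y \in p -> t \in S -> adj G y t ->
     [set y; t] \in cycle_edges (x :: q ++ p ++ q')) ->
  deltas (size p)./2 S (S :\: [set y in p]).
Proof.
set c := x :: _; case/andP=> sz /andP[cy un] evp lS pS clo.
have [up sp] : uniq p /\ sorted (adj G) p.
  split; first by move: un; rewrite /c cons_uniq !cat_uniq => /andP[_] =>  /and3P[_ _ /andP[]].
  move: cy; rewrite /c /= rcons_path !cat_path => /andP[/and3P[_ pp _] _].
  exact: path_sorted pp.
apply: deltas_path => // p1 y z p2 pE t tS yt.
have yp : y \in p by rewrite pE mem_cat inE eqxx orbT.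
have cE : c = (x :: q ++ p1) ++ [:: y, z & p2 ++ q'].
  by rewrite /c pE -!catA /= -!catA.
have := clo y t yp tS yt; case/cycle_edgesP => -[_ E].
  by rewrite E cE next_cat_uniq ?eqxx // -cE.
have tE : t = last x (q ++ p1).
  rewrite -(prev_next un t) -E -(prev_next un (last x (q ++ p1))); congr (prev c _).
  have cE' : c = belast x (q ++ p1) ++ [:: last x (q ++ p1), y, z & p2 ++ q'].
    by rewrite cE -[RHS]cat_rcons -lastI.
  by rewrite cE' next_cat_uniq // -cE'.
move: tS; rewrite tE; case/lastP: (p1) => [|p1' l]; first by rewrite cats0 (negbTE lS).
by move=> _; rewrite last_cat last_rcons mem_rcons inE eqxx orbT.
Qed.

End CyclesAndDeltas.

(** * Graphs attaining equality in the rank inequality *)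

Section TightGraphs.
Variables (F : fieldType) (T : finType) (G : sgraph T) (a b : T -> T -> F).
Variables (wa : weighting G a) (wb : weighting G b).
Implicit Types (S A B : {set T}) (c p q : seq T) (w : T -> T -> F).

Definition tight S : Prop := (rk a S)%:Z = (rk b S)%:Z + 2%:Z * dim_in G S.

Lemma deltas_rk w m S S' : weighting G w -> deltas G m S S' ->
  rk w S = (rk w S' + m.*2)%N.
Proof.
move=> ww; elim=> [{}S|{}m {}S {}S' u v uS vS du uv _ IH]; first by rewrite addn0.
by rewrite (rk_delta ww uS vS du uv) IH doubleS; lia.
Qed.

Lemma tight_setD1 S c x : tight S -> is_cycle G c -> {subset c <= S} -> x \in c ->
  tight (S :\ x) /\ dim_in G (S :\ x) = dim_in G S - 1.
Proof.
move=> tS cc cS xc; have := dim_in_cycle cc cS xc (subxx _).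
have := rk_setD1 a S x; have := rk_subset b (subD1set S x).
have := rank_gap (S :\ x) wa wb; move: tS; rewrite /tight; lia.
Qed.

Lemma tight_delta S u v : tight S -> u \in S -> v \in S ->
  degree_in G S u = 1%N -> adj G u v ->
  tight (S :\: [set u; v]) /\ dim_in G (S :\: [set u; v]) = dim_in G S.
Proof.
move=> tS uS vS du uv; move: tS; rewrite /tight.
rewrite (rk_delta wa uS vS du uv) (rk_delta wb uS vS du uv) !PoszD.
have := dim_in_mono G (subsetDl S [set u; v]).
have := rank_gap (S :\: [set u; v]) wa wb; lia.
Qed.

Lemma tight_deltas m S S' : deltas G m S S' -> tight S ->
  tight S' /\ dim_in G S' = dim_in G S.
Proof.
elim=> // {}m {}S {}S' u v uS vS du uv _ IH tS.
by have [/IH[tS' ->] ->] := tight_delta tS uS vS du uv.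
Qed.

(** A cycle destroyed by a delta-transformation would lower the dimension, which
   is unchanged in a tight graph. *)
Lemma tight_delta_cycle S u v c : tight S -> u \in S -> v \in S ->
  degree_in G S u = 1%N -> adj G u v -> is_cycle G c -> {subset c <= S} ->
  {subset c <= S :\: [set u; v]}.
Proof.
move=> tS uS vS du uv cc cS x xc; rewrite inE cS // andbT.
apply/negP => xuv; have [_ dE] := tight_delta tS uS vS du uv.
have : S :\: [set u; v] \subset S :\ x.
  by apply/subsetP => y; rewrite !inE => /andP[N ->]; rewrite andbT; apply: contraNneq N => ->;
     move: xuv; rewrite !inE.
by move/(dim_in_cycle cc cS xc); rewrite dE; lia.
Qed.

Lemma rel_cycle_del S c x t : is_cycle G c -> {subset c <= S} ->
  [set x; t] \notin cycle_edges c -> rel_cycle (del_edge (adj_in G S) x t) c.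
Proof.
move=> cc cS N; have /andP[sz /andP[cy un]] : rel_cycle (adj_in G S) c by apply/cycle_inP.
apply/andP; split=> //; apply/andP; split=> //.
apply: cycle_from_next => // y yc; rewrite /del_edge (next_cycle cy yc) /=.
by apply: contraNneq N => <-; apply: imset_f.
Qed.

(** If xt were not a bridge, deleting it would lower the dimension and preserve the
   cycle c, which deleting x would then break as well, whereas deleting x from a
   tight graph lowers the dimension by 1 only. *)
Lemma tight_bridge S c x t : tight S -> is_cycle G c -> {subset c <= S} ->
  x \in c -> t \in S -> adj G x t -> [set x; t] \notin cycle_edges c ->
  ~~ connect (del_edge (adj_in G S) x t) x t.
Proof.
move=> tS cc cS xc tS' xt N; apply/negP => con.
have [_ dE] := tight_setD1 tS cc cS xc.
have es := @adj_in_sym _ G S.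
have ext : adj_in G S x t by rewrite /adj_in cS // tS'.
have sub : subrel (adj_in G (S :\ x)) (del_edge (adj_in G S) x t).
  move=> y z yz; rewrite /del_edge (adj_in_sub (subD1set S x) yz) /= eq_set2.
  move: yz => /and3P[]; rewrite !inE => /andP[/negbTE-> _] /andP[/negbTE-> _] _.
  by rewrite andbF.
have := rel_dim_cycle (del_edge_sym x t es) (@adj_in_sym _ G _) sub
   (rel_cycle_del cc cS N) xc.
have -> : adj_in G (S :\ x) x (next c x) = false by rewrite /adj_in !inE eqxx.
move=> /(_ isT); rewrite rel_dim_del_edge // con /= -/(dim_in G _) dE -/(dim_in G _).
by lia.
Qed.

Definition chordless c :=
  {in c &, forall x y, adj G x y -> [set x; y] \in cycle_edges c}.

Lemma tight_chordless S c : tight S -> is_cycle G c -> {subset c <= S} ->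
  chordless c.
Proof.
move=> tS cc cS x y xc yc xy; apply/negPn/negP => N.
case/negP: (tight_bridge tS cc cS xc (cS _ yc) xy N).
have /andP[_ /andP[cy _]] := rel_cycle_del cc cS N.
exact: (connect_cycle cy).
Qed.

Lemma next_closed_subset c A x : uniq c -> x \in c -> x \in A ->
  (forall y, y \in c -> y \in A -> next c y \in A) -> {subset c <= A}.
Proof.
move=> un xc xA clo y; rewrite -(fconnect_cycle (cycle_next un) xc).
case/connectP=> p pp ->; elim: p x xc xA pp => //= z p IH x xc xA /andP[/eqP<- pp].
by apply: IH pp; rewrite ?mem_next //; apply: clo.
Qed.

(** If two cycles share a vertex y, then the edge of one at y belongs to the other,
   since it is not a bridge; following the first cycle from y, all of its
   edges belong to the second one. *)
Lemma tight_cycles_disjoint S c1 c2 : tight S ->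
  is_cycle G c1 -> is_cycle G c2 -> {subset c1 <= S} -> {subset c2 <= S} ->
  cycle_edges c1 <> cycle_edges c2 -> [disjoint c1 & c2].
Proof.
move=> tS; suff main c c' x : is_cycle G c -> is_cycle G c' ->
    {subset c <= S} -> {subset c' <= S} -> x \in c -> x \in c' ->
    cycle_edges c \subset cycle_edges c'.
  move=> cc1 cc2 c1S c2S N; apply/pred0P => x; apply/negP => /andP[/= x1 x2].
  by case: N; apply/eqP; rewrite eqEsubset !(main _ _ x).
move=> cc cc' cS cS' xc xc'.
have step y : y \in c -> y \in c' -> [set y; next c y] \in cycle_edges c'.
  move=> yc yc'; apply/negPn/negP => N.
  have rc : rel_cycle (adj_in G S) c by apply/cycle_inP.
  have nS : next c y \in S by rewrite cS // mem_next.
  have ay : adj G y (next c y).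
    by case/andP: cc => _ /andP[cy _]; apply: next_cycle.
  case/negP: (tight_bridge tS cc' cS' yc' nS ay N).
  exact: connect_next_del_edge (@adj_in_sym _ G S) rc yc.
have sub : {subset c <= [set y in c']}.
  apply: (@next_closed_subset _ _ x) => //; rewrite ?inE //.
    by case/andP: cc => _ /andP[].
  by move=> y yc; rewrite !inE => /(step y yc)/cycle_edges_mem[].
apply/subsetP => f /imsetP[y yc ->]; apply: step => //.
by have := sub y yc; rewrite inE.
Qed.

(** Deleting one vertex of a cycle leaves a path, whose vertices can be removed by
   delta-transformations, up to one when their number is odd. *)
Lemma cycle_rk_bounds w c : weighting G w -> is_cycle G c -> chordless c ->
  ((size c).-1./2.*2 <= rk w [set x in c] <= size c)%N.
Proof.
move=> ww cc ch; have un : uniq c by case/andP: cc => _ /andP[].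
apply/andP; split; last first.
  apply: leq_trans (rk_leq_card _ _) _.
  by rewrite cardsE (card_uniqP un).
case: c cc ch un => [|x r] // cc ch un; set S := [set y in _].
apply: leq_trans (rk_subset w (subD1set S x)).
set k := (size r)./2.*2.
have kr : (k <= size r)%N by rewrite -[X in (_ <= X)%N](odd_double_half (size r)) leq_addl.
have st : size (take k r) = k by rewrite size_take_min; apply/minn_idPl.
have inr y : y \in take k r -> y \in r by apply: mem_take.
have := @deltas_arc _ G x [::] (take k r) (drop k r) (S :\ x).
rewrite /= cat_take_drop st odd_double doubleK => /(_ cc isT).
move=> H; rewrite (deltas_rk ww (H _ _ _)) ?leq_addl //.
- by rewrite !inE eqxx.
- move=> y /inr yr; rewrite !inE yr orbT andbT.
  by apply: contraTneq yr => ->; case/andP: un.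
move=> y t /inr yr; rewrite !inE => /andP[_ tc] yt.
by apply: ch => //; rewrite inE ?yr ?orbT.
Qed.

End TightGraphs.

(** * Structure of tight graphs *)

Section Decomposition.
Variables (F : fieldType) (T : finType) (G : sgraph T) (a b : T -> T -> F).
Variables (wa : weighting G a) (wb : weighting G b).
Implicit Types (S A B H : {set T}) (c p q : seq T) (w : T -> T -> F).

Notation tight := (tight G a b).

Definition rank_gap2 c : Prop := rk a [set x in c] = (rk b [set x in c] + 2)%N.

Definition at_most_one_exit S A : Prop := forall x t x' t',
  x \in A -> t \in S :\: A -> adj G x t ->
  x' \in A -> t' \in S :\: A -> adj G x' t' -> x = x' /\ t = t'.

Lemma degree_in_eq A S x : A \subset S ->
  (forall t, t \in S -> adj G x t -> t \in A) -> degree_in G A x = degree_in G S x.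
Proof.
move=> /subsetP sAS nb; apply: eq_card => t; rewrite !inE.
by apply/andP/andP => [[/sAS]|[tS xt]] //; split=> //; apply: nb.
Qed.

Lemma cycle_edges_adj c x y : is_cycle G c -> [set x; y] \in cycle_edges c -> adj G x y.
Proof.
case/andP=> _ /andP[cy _] /cycle_edgesP[] [xc ->]; last rewrite adj_sym;
  exact: next_cycle.
Qed.

Lemma deltas_no_pendant m S S' : {in S, forall x, degree_in G S x != 1%N} ->
  deltas G m S S' -> S' = S.
Proof. by move=> np d; case: d np => // {}m {}S {}S' u v uS _ du _ _ /(_ u uS)/eqP. Qed.

Lemma tight_isolated S x : {in S, forall t, ~~ adj G x t} -> tight S -> tight (S :\ x).
Proof.
move=> iso; rewrite /tight.
have E w : weighting G w -> rk w (S :\ x) = rk w S.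
  move=> ww; apply: rk_eq_edges => u v; rewrite !inE.
  case: (eqVneq u x) => [->|_] /=.
    by case: ifP => // /andP[_ vS]; rewrite (weighting0 ww) // iso.
  case: (eqVneq v x) => [->|_] //=; rewrite andbF.
  by case: ifP => // /andP[uS _]; rewrite (weighting0 ww) // adj_sym iso.
rewrite !E //; suff -> : dim_in G (S :\ x) = dim_in G S by [].
apply: eq_rel_dim => u v; rewrite /adj_in !inE.
case: (eqVneq u x) => [->|_] /=.
  by apply/esym/negP => /and3P[_ vS]; apply/negP/iso.
case: (eqVneq v x) => [->|_] //=; rewrite andbF.
by apply/esym/negP => /and3P[uS _]; rewrite adj_sym; apply/negP/iso.
Qed.

(** Take a smallest set B meeting an edge of S and left by at most one edge. It
   contains a cycle. An edge from that cycle to another vertex of B would be a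
   bridge and cut B into two parts; the part not incident to the edge leaving B
   would be a smaller such set. So any edge leaving the cycle leaves B. *)
Lemma pendant_cycle S B y t : tight S -> {in S, forall x, degree_in G S x != 1%N} ->
  B \subset S -> at_most_one_exit S B -> y \in B -> t \in S -> adj G y t ->
  exists c, [/\ is_cycle G c, {subset c <= S} & at_most_one_exit S [set x in c]].
Proof.
move=> tS np; have [n] := ubnP #|B|; elim: n B y t => // n IH B y t ltn sBS ex yB tS' yt.
have sBS' := subsetP sBS.
have [c cc cB] : exists2 c, is_cycle G c & {subset c <= B}.
  case: (boolP [exists x in B, exists z in S :\: B, adj G x z]).
    case/exists_inP=> x xB /exists_inP[z zSB xz].
    have zS : z \in S by case/setDP: zSB.
    have [u [uS xu uz]] := other_nbr (np x (sBS' _ xB)) zS xz.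
    have uB : u \in B.
      apply: contraR uz => uB; have [] := ex x z x u => //; last by move=> _ ->.
      by rewrite inE uB.
    apply: (exists_cycle xB uB xu) => v vB vx.
    rewrite (degree_in_eq sBS) ?np ?sBS' // => s sS vs.
    apply: contraR vx => sB; have [] := ex v s x z => //; last by move=> ->.
    by rewrite inE sB.
  move=> noex; have nb u v : u \in B -> v \in S -> adj G u v -> v \in B.
    move=> uB vS uv; apply: contraR noex => vB; apply/exists_inP; exists u => //.
    by apply/exists_inP; exists v => //; rewrite inE vB.
  apply: (exists_cycle yB (nb _ _ yB tS' yt) yt) => v vB _.
  by rewrite (degree_in_eq sBS) ?np ?sBS' // => s sS vs; apply: nb vs.
have cS : {subset c <= S} by move=> x /cB/sBS'.
case: (boolP [exists x in c, exists s in B, (s \notin c) && adj G x s]); last first.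
  move=> noex; exists c; split=> // u s u' s'; rewrite !inE.
  move=> uc /andP[sc sS] us u'c /andP[s'c s'S] us'.
  have out v r : v \in c -> r \notin c -> r \in S -> adj G v r -> r \in S :\: B.
    move=> vc rc rS vr; rewrite inE rS andbT; apply: contraNN noex => rB.
    by apply/exists_inP; exists v => //; apply/exists_inP; exists r; rewrite ?rc.
  by apply: ex; rewrite ?cB //; [apply: (out u) | apply: (out u')].
case/exists_inP=> x xc /exists_inP[s sB /andP[sc xs]].
have xB := cB _ xc.
set e := del_edge (adj_in G B) x s.
have es : symmetric e by apply: del_edge_sym; apply: adj_in_sym.
have nxs : ~~ connect e s x.
  have N : [set x; s] \notin cycle_edges c.
    by apply: contraNN sc => /cycle_edges_mem[].
  apply: contraNN (tight_bridge wa wb tS cc cS xc (sBS' _ sB) xs N).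
  rewrite (sym_connect_sym es); apply: connect_sub => u v /andP[uv N'].
  by apply: connect1; rewrite /del_edge (adj_in_sub sBS uv).
pose B1 := [set u in B | connect e s u].
have sB1 : s \in B1 by rewrite inE sB connect0.
have xB1 : x \notin B1 by rewrite inE negb_and nxs orbT.
have sub1 : B1 \subset B by apply/subsetP => u; rewrite inE => /andP[].
have sub1' := subsetP sub1.
have inner u v : u \in B1 -> v \in B :\: B1 -> adj G u v -> u = s /\ v = x.
  case/setIdP=> uB cu /setDP[vB]; rewrite inE vB /= => ncv uv.
  have : ~~ e u v by apply: contraNN ncv => euv; apply: connect_trans cu (connect1 euv).
  rewrite /e /del_edge /adj_in uB vB uv negbK eq_set2.
  case/orP=> /andP[/eqP Eu /eqP Ev] //.
  by move: nxs; rewrite -Eu cu.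
have card1 : (#|B1| < n)%N.
  apply: leq_trans (_ : #|B| <= _)%N => //; apply: proper_card.
  by apply/properP; split=> //; exists x.
have card2 : (#|B :\: B1| < n)%N.
  apply: leq_trans (_ : #|B| <= _)%N => //; apply: proper_card.
  by apply/properP; split; [apply: subsetDl | exists s => //; rewrite inE sB1].
have sx : adj G s x by rewrite adj_sym.
case: (boolP [exists u in B1, exists v in S :\: B, adj G u v]) => [|noex]; last first.
  apply: (IH B1 s x card1 (subset_trans sub1 sBS)) => //; last exact: cS.
  have only u v : u \in B1 -> v \in S :\: B1 -> adj G u v -> u = s /\ v = x.
    move=> uB /setDP[vS vB1] uv; apply: inner => //; rewrite inE vB1 /=.
    apply: contraR noex => vB; apply/exists_inP; exists u => //.
    by apply/exists_inP; exists v => //; rewrite inE vB.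
  by move=> u v u' v' uB vB uv uB' vB' uv'; case: (only u v) => // -> ->; case: (only u' v').
case/exists_inP=> u1 u1B /exists_inP[v1 v1B uv1].
apply: (IH (B :\: B1) x s card2 (subset_trans (subsetDl _ _) sBS)) => //; last 2 first.
- by rewrite inE xB1.
- exact: sBS'.
have only u v : u \in B :\: B1 -> v \in S :\: (B :\: B1) -> adj G u v -> u = x /\ v = s.
  move=> uB /setDP[vS vB] uv; case/setDP: (uB) => uB' uB1.
  case: (boolP (v \in B)) => vB'.
    have vB1 : v \in B1 by move: vB; rewrite inE vB' andbT negbK.
    by case: (inner v u vB1 uB); rewrite 1?adj_sym.
  have vSB : v \in S :\: B by rewrite inE vB'.
  by have [E] := ex u v u1 v1 uB' vSB uv (sub1' _ u1B) v1B uv1; rewrite E u1B in uB1.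
by move=> u v u' v' uB vB uv uB' vB' uv'; case: (only u v) => // -> ->; case: (only u' v').
Qed.

(** The conclusion of the structure theorem, named because it is also the
   induction hypothesis of the lemmas that exclude the pendant cycles. *)
Definition structured S : Prop :=
  (exists m S' k, [/\ deltas G m S S', k%:Z = dim_in G S & cycles_and_isolated G S' k]) /\
  (forall c, is_cycle G c -> {subset c <= S} -> rank_gap2 c).

(** Follow the pendant path that starts with x and z: as long as z has one neighbour
   in H, it plays the role of x in the smaller graph, and when the path reaches a
   vertex z of higher degree, H has no pendant vertex left. Then H consists of
   cycles and isolated vertices, so z is on a cycle, next to the pendant vertex x. *)
Lemma no_hanging_edge n H x z :
  (forall S, (#|S| < n)%N -> tight S -> structured S) ->
  (#|H| < n)%N -> x \notin H -> z \in H -> adj G x z ->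
  {in H, forall t, adj G x t -> t = z} -> tight (x |: H) -> tight H ->
  (exists2 t, t \in H & adj G z t) ->
  (forall u, u \in H -> u != z -> degree_in G H u != 1%N) -> False.
Proof.
move=> IH; have [k] := ubnP #|H|; elim: k H x z => // k IHk H x z ltk ltn xH zH xz nx tK tH.
case=> t tH' zt np; set K := x |: H in tK.
have xK : x \in K by rewrite !inE eqxx.
have zK : z \in K by rewrite !inE zH orbT.
have dx : degree_in G K x = 1%N.
  apply: degree_in_eq1 zK xz _ => s; rewrite !inE => /predU1P[->|]; last exact: nx.
  by rewrite adj_irr.
have KE : K :\: [set x; z] = H :\ z.
  apply/setP => s; rewrite !inE; case: (eqVneq s x) => [->|] //=.
  by rewrite (negbTE xH) andbF.
have [dz|dz] := eqVneq (degree_in G H z) 1%N; last first.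
  have npH : {in H, forall u, degree_in G H u != 1%N}.
    by move=> u uH; have [->|uz] := eqVneq u z; last exact: np.
  have [[m [S' [j [d _ ci]]]] _] := IH H ltn tH.
  move: ci; rewrite (deltas_no_pendant npH d) => -[cs [_ csP _ edge]].
  have := zt; rewrite edge // => /hasP[c ccs /cycle_edges_mem[zc _]].
  have [cc cH] := csP c ccs.
  have cK : {subset c <= K} by move=> u /cH; rewrite !inE => ->; rewrite orbT.
  have := tight_delta_cycle wa wb tK xK zK dx xz cc cK zc.
  by rewrite !inE eqxx orbT.
have [tHz _] := tight_delta wa wb tK xK zK dx xz; rewrite KE in tHz.
have tz : t != z by apply: contraTneq zt => ->; rewrite adj_irr.
have tz' : adj G t z by rewrite adj_sym.
have cardz : (#|H :\ z| < #|H|)%N by rewrite (cardsD1 z H) zH.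
apply: (IHk (H :\ z) z t) => //.
- exact: leq_trans cardz ltk.
- exact: ltn_trans cardz ltn.
- by rewrite !inE eqxx.
- by rewrite !inE tz.
- by move=> s /setD1P[_ sH] zs; apply: pendant_nbr dz tH' zt sH zs.
- by rewrite setD1K.
- have [s [sH ts sz]] := other_nbr (np t tH' tz) zH tz'.
  by exists s; rewrite // !inE sz.
move=> u /setD1P[uz uH] ut; rewrite (degree_in_eq (subD1set H z)) ?np //.
move=> s sH us; rewrite !inE sH andbT; apply: contraNneq ut => sz.
by apply/eqP; apply: pendant_nbr dz tH' zt uH _; rewrite adj_sym -sz.
Qed.

Lemma eq_cycle_edges_mem c c' : cycle_edges c = cycle_edges c' -> c =i c'.
Proof.
move=> E; have sub p q : cycle_edges p = cycle_edges q -> {subset p <= q}.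
  move=> Epq x xp; have : [set x; next p x] \in cycle_edges q by rewrite -Epq; apply: imset_f.
  by case/cycle_edges_mem.
by move=> x; apply/idP/idP; apply: sub.
Qed.

(** The ranks are additive. The gap of the cycle is at most 2, and the dimension of
   the rest is smaller by at least 1, so equality for S forces equality in both. *)
Lemma tight_isolated_cycle S c : tight S -> is_cycle G c -> {subset c <= S} ->
  (forall x t, x \in c -> t \in S -> adj G x t -> t \in c) ->
  let H := S :\: [set x in c] in
  [/\ rank_gap2 c, tight H & dim_in G H = dim_in G S - 1].
Proof.
move=> tS cc cS iso; set C := [set x in c]; move=> H.
have sCS : C \subset S by apply/subsetP => x; rewrite inE => /cS.
have split w : weighting G w -> rk w S = (rk w C + rk w H)%N.
  move=> ww; apply: rk_disjoint => // x y; rewrite inE => xc /setDP[yS].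
  rewrite inE => yc; have N : ~~ adj G x y by apply: contraNN yc; apply: iso.
  by rewrite !(weighting0 ww) // adj_sym.
have ch : chordless G c := tight_chordless wa wb tS cc cS.
have /andP[_ upa] := cycle_rk_bounds wa cc ch.
have /andP[lob _] := cycle_rk_bounds wb cc ch.
have [x xc] : exists x, x \in c.
  by case/andP: cc; case: (c) => // x ? _ _; exists x; rewrite inE eqxx.
have sHS : H \subset S :\ x.
  by apply/subsetP => y; rewrite !inE => /andP[yc ->]; rewrite andbT; apply: contraNneq yc => ->.
have dH := dim_in_cycle cc cS xc sHS.
have gH := rank_gap H wa wb.
have gap2 : (rk a C <= rk b C + 2)%N.
  apply: leq_trans upa (leq_trans _ (leq_add lob (leqnn 2))).
  by case: (size c) => // k; rewrite /= -[in X in (X <= _)%N](odd_double_half k);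
    case: (odd k) => /=; lia.
move: tS; rewrite /rank_gap2 -/C /tight !split // !PoszD => tS.
by split; lia.
Qed.

(** Both ranks of an odd cycle of length q lie between q - 1 and q. *)
Lemma rank_gap2_even c : is_cycle G c -> chordless G c -> rank_gap2 c -> ~~ odd (size c).
Proof.
move=> cc ch gc.
have /andP[_ upa] := cycle_rk_bounds wa cc ch.
have /andP[lob _] := cycle_rk_bounds wb cc ch.
move: upa lob; rewrite gc; case: (size c) => // k /=.
rewrite -[X in (_ <= X.+1)%N -> _](odd_double_half k).
by case: (odd k) => //=; rewrite add0n; lia.
Qed.

Lemma structured_isolated_cycle S c : tight S ->
  {in S, forall x, degree_in G S x != 1%N} -> is_cycle G c -> {subset c <= S} ->
  (forall x t, x \in c -> t \in S -> adj G x t -> t \in c) ->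
  structured (S :\: [set x in c]) -> structured S.
Proof.
move=> tS np cc cS iso; set H := S :\: _ => -[[m [S' [k [d kE ci]]]] gH].
have [gc tH dH] := tight_isolated_cycle tS cc cS iso.
have un : uniq c by case/andP: cc => _ /andP[].
have inH x : (x \in H) = (x \notin c) && (x \in S) by rewrite !inE.
have npH : {in H, forall x, degree_in G H x != 1%N}.
  move=> x; rewrite inH => /andP[xc xS].
  rewrite (degree_in_eq (subsetDl _ _)) ?np // => t tS' xt.
  by rewrite inH tS' andbT; apply: contraNN xc => tc; apply: iso tc xS _; rewrite adj_sym.
move: ci; rewrite (deltas_no_pendant npH d) => -[cs [sz csP ufl edge]].
split; last first.
  move=> c2 cc2 c2S; have [E|N] := eqVneq (cycle_edges c2) (cycle_edges c).
    rewrite /rank_gap2 (_ : [set x in c2] = [set x in c]) //.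
    by apply/setP => x; rewrite !inE (eq_cycle_edges_mem E).
  have dis := tight_cycles_disjoint wa wb tS cc2 cc c2S cS (elimN eqP N).
  by apply: gH => // x xc2; rewrite inH c2S // (disjointFr dis xc2).
exists 0%N, S, k.+1; split; first by constructor.
  by move: kE; rewrite dH; lia.
exists (c :: cs); split => /=; first by rewrite sz.
- move=> c'; rewrite inE => /predU1P[->|/csP[cc' c'H]] //; split=> // x /c'H.
  by rewrite inH => /andP[].
- rewrite cat_uniq un ufl andbT /=; apply/hasPn => x /flattenP[c' /csP[_ c'H] /c'H].
  by rewrite inH => /andP[].
move=> x y xS yS; apply/idP/orP; last first.
  case=> [|/hasP[c' /csP[cc' _]]]; exact: cycle_edges_adj.
move=> xy; case: (boolP (x \in c)) => xc.
  by left; apply: (tight_chordless wa wb tS cc cS) => //; apply: iso xy.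
right; rewrite -edge // inH ?xc ?xS // yS andbT; apply: contraNN xc => yc.
by apply: iso yc xS _; rewrite adj_sym.
Qed.

(** Once one vertex of the cycle is deleted, delta-transformations remove what
   remains of it and leave, besides isolated vertices, either the rest H alone or H
   with x hanging from z; both are then tight, which no_hanging_edge excludes.
   For this the cycle must have even length, so that a path with an odd
   number of vertices is left. *)
Lemma no_pendant_cycle S x r z : tight S ->
  (forall S', (#|S'| < #|S|)%N -> tight S' -> structured S') ->
  {in S, forall u, degree_in G S u != 1%N} ->
  is_cycle G (x :: r) -> {subset x :: r <= S} ->
  at_most_one_exit S [set y in x :: r] ->
  z \in S -> z \notin x :: r -> adj G x z -> False.
Proof.
move=> tS IH np cc cS; set c := x :: r in cc cS *; set C := [set y in c] => ex zS zc xz.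
have xc : x \in c by rewrite inE eqxx.
have un : uniq c by case/andP: cc => _ /andP[].
pose H := S :\: C.
have inH u : (u \in H) = (u \notin c) && (u \in S) by rewrite !inE.
have exit u t : u \in c -> t \in S -> t \notin c -> adj G u t -> u = x /\ t = z.
  by move=> uc tS' tc ut; apply: ex; rewrite ?inE ?tc ?zc.
have zH : z \in H by rewrite inH zc.
have zx : adj G z x by rewrite adj_sym.
have [t [tS' zt tx]] := other_nbr (np z zS) (cS x xc) zx.
have tH : t \in H.
  rewrite inH tS' andbT; apply: contraNN tx => tc.
  by have [|-> //] := exit t z tc zS zc; rewrite adj_sym.
have npH u : u \in H -> u != z -> degree_in G H u != 1%N.
  rewrite inH => /andP[uc uS] uz; rewrite (degree_in_eq (subsetDl _ _)) ?np //.
  move=> s sS us; rewrite inH sS andbT; apply: contraNN uz => sc.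
  by have [|_ -> //] := exit s u sc uS uc; rewrite adj_sym.
have ch : chordless G c := tight_chordless wa wb tS cc cS.
have clo u s : u \in r -> s \in S -> adj G u s -> [set u; s] \in cycle_edges c.
  move=> ur sS us; have uc : u \in c by rewrite inE ur orbT.
  apply: ch => //; apply/negPn/negP => sc; have [ux _] := exit u s uc sS sc us.
  by move: un; rewrite /c /= -ux ur.
have oddr : odd (size r).
  (* H has no pendant vertex but z, so it contains a cycle; breaking that cycle
     makes the induction hypothesis available for c. *)
  have [c' cc' c'H] := exists_cycle zH tH zt npH.
  have [y yc'] : exists y, y \in c'.
    by case/andP: cc'; case: (c') => // y ? _ _; exists y; rewrite inE eqxx.
  have yH := c'H y yc'; move: (yH); rewrite inH => /andP[yc yS].
  have c'S : {subset c' <= S} by move=> u /c'H; rewrite inH => /andP[].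
  have [tSy _] := tight_setD1 wa wb tS cc' c'S yc'.
  have lty : (#|S :\ y| < #|S|)%N by rewrite (cardsD1 y S) yS.
  have [_ gapS] := IH _ lty tSy.
  have : rank_gap2 c.
    apply: gapS => // u uc; rewrite !inE cS // andbT; apply: contraNneq yc => <-.
    exact: uc.
  by move/(rank_gap2_even cc ch); rewrite /c /= negbK.
case: r @c C @H cc cS ex zc xc un inH exit zH tH npH ch clo oddr => // c1 p2.
move=> c C H cc cS ex zc xc un inH exit zH tH npH ch clo; rewrite /= => evp.
have c1c : c1 \in c by rewrite !inE eqxx orbT.
have [xr ur] : x \notin c1 :: p2 /\ uniq (c1 :: p2) by case/andP: un.
have [x1 xp2] : x != c1 /\ x \notin p2 by move: xr; rewrite inE negb_or => /andP[].
have [c1p2 up2] : c1 \notin p2 /\ uniq p2 by case/andP: ur.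
have tK : tight (x |: H).
  (* Delete the successor c1 of x: the last vertex of the stretch p2 is removed
     together with its predecessor, although it is a neighbour of x. *)
  have [tS1 _] := tight_setD1 wa wb tS cc cS c1c.
  have := @deltas_arc _ G x [:: c1] p2 [::] (S :\ c1).
  rewrite /= cats0 => /(_ cc evp) D.
  have {}D : deltas G (size p2)./2 (S :\ c1) (S :\ c1 :\: [set y in p2]).
    apply: D; first by rewrite !inE eqxx.
      move=> u up; rewrite !inE cS ?inE ?up ?orbT // andbT.
      by apply: contraNneq c1p2 => <-.
    by move=> u s up /setD1P[_ sS]; apply: clo => //; rewrite inE up orbT.
  have [] := tight_deltas wa wb D tS1.
  suff -> : S :\ c1 :\: [set y in p2] = x |: H by [].
  apply/setP => u; rewrite in_setU1 inH /c !in_cons !inE; case: (eqVneq u x) => [->|ux] /=.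
    by rewrite x1 xp2 cS.
  by case: (u == c1); case: (u \in p2).
have tH' : tight H.
  (* Delete x: an odd number of vertices is left, the last of which, l, ends up
     isolated. *)
  have [tSx _] := tight_setD1 wa wb tS cc cS xc.
  set p := belast c1 p2; set l := last c1 p2.
  have rE : c1 :: p2 = p ++ [:: l] by rewrite lastI cats1.
  have lr : l \in c1 :: p2 by apply: mem_last.
  have pr u : u \in p -> u \in c1 :: p2 by apply: mem_belast.
  have := @deltas_arc _ G x [::] p [:: l] (S :\ x).
  rewrite /= -rE => /(_ cc); rewrite size_belast => /(_ evp) D.
  have {}D : deltas G (size p2)./2 (S :\ x) (S :\ x :\: [set y in p]).
    apply: D; first by rewrite !inE eqxx.
      move=> u /pr up; apply/setD1P; split; last by apply: cS; rewrite /c in_cons up orbT.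
      by apply: contraNneq xr => <-.
    by move=> u s /pr up /setD1P[_ sS]; apply: clo.
  have [tl _] := tight_deltas wa wb D tSx.
  have lp : l \notin p by move: ur; rewrite rE cats1 rcons_uniq => /andP[].
  have lx : l != x by apply: contraNneq xr => <-.
  have -> : H = (S :\ x :\: [set y in p]) :\ l.
    apply/setP => u; rewrite inH /c (in_cons x) rE mem_cat !inE.
    by case: (u == x); case: (u \in p); case: (u == l); rewrite ?orbT ?andbT ?andbF.
  apply: tight_isolated tl => s; rewrite !inE => /andP[sp /andP[sx sS]].
  apply/negP => ls; have sc : s \notin c.
    rewrite /c (in_cons x) (negbTE sx) rE mem_cat inE (negbTE sp) /=.
    by apply: contraTneq ls => ->; rewrite adj_irr.
  have lc : l \in c by rewrite /c in_cons lr orbT.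
  by have [E _] := exit l s lc sS sc ls; rewrite E eqxx in lx.
apply: (no_hanging_edge IH (H := H) (x := x) (z := z)) => //.
- apply: proper_card; apply/properP; split; first exact: subsetDl.
  by exists x; rewrite ?cS // inH xc.
- by rewrite inH xc.
- by move=> s; rewrite inH => /andP[sc sS] xs; case: (exit x s).
- by exists t.
Qed.

Lemma tight_structured S : tight S -> structured S.
Proof.
have [n] := ubnP #|S|; elim: n S => // n IHn S ltn tS.
have IH S' : (#|S'| < #|S|)%N -> tight S' -> structured S'.
  by move=> lt; apply: IHn; apply: leq_trans lt ltn.
case: (boolP [exists u in S, degree_in G S u == 1%N]) => [|/exists_inPn np].
  case/exists_inP=> u uS /eqP du; have [v vS uv] := degree1_nbr du.
  have [tS' dE] := tight_delta wa wb tS uS vS du uv.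
  have [|[m [S' [k [d kE ci]]]] gS'] := IH (S :\: [set u; v]) _ tS'.
    apply: proper_card; apply/properP; split; first exact: subsetDl.
    by exists u; rewrite // !inE eqxx.
  split; last first.
    move=> c cc cS; apply: gS' => //.
    exact: tight_delta_cycle tS uS vS du uv cc cS.
  exists m.+1, S', k; split=> //; last by rewrite -dE.
  exact: deltas_cons du uv d.
case: (boolP [exists x in S, exists y in S, adj G x y]); last first.
  move=> noE; have {}noE : {in S &, forall x y, ~~ adj G x y}.
    move=> x y xS yS; apply: contraNN noE => xy.
    by apply/exists_inP; exists x => //; apply/exists_inP; exists y.
  split=> [|c]; last first.
    case/andP=> sz /andP[cy _] cS; case: c sz cy cS => [|x [|y c]] // _ /andP[xy _] cS.
    have [xS yS] : x \in S /\ y \in S by rewrite !cS ?inE ?eqxx ?orbT.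
    by move: (noE x y xS yS); rewrite xy.
  exists 0%N, S, 0%N; split; [by constructor | by rewrite dim_in_edgeless |].
  by exists [::]; split=> // x y xS yS; apply/negbTE/noE.
case/exists_inP=> y yS /exists_inP[t tS' yt].
have ex0 : at_most_one_exit S S by move=> u v ? ? ?; rewrite setDv inE.
have [c [cc cS ex]] := pendant_cycle tS np (subxx S) ex0 yS tS' yt.
case: (boolP [exists x in c, exists z in S, (z \notin c) && adj G x z]); last first.
  move=> noex; have iso x s : x \in c -> s \in S -> adj G x s -> s \in c.
    move=> xc sS xs; apply: contraNT noex => sc; apply/exists_inP; exists x => //.
    by apply/exists_inP; exists s => //; rewrite sc.
  apply: (structured_isolated_cycle tS np cc cS iso).
  have [_ tH _] := tight_isolated_cycle tS cc cS iso.
  apply: IH tH; apply: proper_card; apply/properP; split; first exact: subsetDl.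
  case: c cc cS {ex iso noex} => [|x c] // _ cS.
  by exists x; rewrite ?cS ?inE ?eqxx.
case/exists_inP=> x xc /exists_inP[z zS /andP[zc xz]]; exfalso.
have [i r cE] := rot_to xc.
have mE : c =i x :: r by move=> u; rewrite -cE mem_rot.
apply: (@no_pendant_cycle S x r z) => //.
- by case/andP: cc => sz /andP[cy un]; rewrite -cE /is_cycle /ucycleb size_rot rot_cycle rot_uniq sz cy.
- by move=> u; rewrite -mE => /cS.
- suff <- : [set u in c] = [set u in x :: r] by [].
  by apply/setP => u; rewrite !inE mE inE.
- by rewrite -mE.
Qed.

Lemma rank_gap_cycles_and_isolated S k : cycles_and_isolated G S k ->
  (forall c, is_cycle G c -> chordless G c -> rank_gap2 c) ->
  rk a S = (rk b S + k.*2)%N.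
Proof.
case=> cs [<- csP ufl edge] gc; elim: cs S csP ufl edge => [|c cs IH] S csP ufl edge.
  by rewrite !(@rk_edgeless _ _ G) // => x y xS yS; rewrite edge.
have [cc cS] : is_cycle G c /\ {subset c <= S} by apply: csP; rewrite inE eqxx.
set C := [set x in c]; set H := S :\: C.
move: ufl; rewrite /= cat_uniq => /and3P[_ /hasPn dis ufl].
have inH x : (x \in H) = (x \notin c) && (x \in S) by rewrite !inE.
have csN c2 x : c2 \in cs -> x \in c2 -> x \notin c.
  by move=> c2cs xc2; apply: dis; apply/flattenP; exists c2.
have out x y : x \in c -> y \in H -> ~~ adj G x y.
  rewrite inH => xc /andP[yc yS]; rewrite edge ?(cS x) //=; apply/negP => /orP[].
    by case/cycle_edges_mem=> _; apply/negP.
  by case/hasP=> c2 c2cs /cycle_edges_mem[/(csN _ _ c2cs)]; rewrite xc.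
have split w : weighting G w -> rk w S = (rk w C + rk w H)%N.
  move=> ww; apply: rk_disjoint; first by apply/subsetP => x; rewrite inE => /cS.
  move=> x y; rewrite inE => xc yH; have N := out x y xc yH.
  by rewrite !(weighting0 ww) // adj_sym.
have IHH : rk a H = (rk b H + (size cs).*2)%N.
  apply: IH => // [c2 c2cs|x y].
    have [cc2 c2S] : is_cycle G c2 /\ {subset c2 <= S} by apply: csP; rewrite inE c2cs orbT.
    by split=> // x xc2; rewrite inH c2S // (csN c2).
  rewrite !inH => /andP[xc xS] /andP[yc yS]; rewrite edge //=.
  by rewrite (_ : _ \in _ = false) //; apply: contraNF xc => /cycle_edges_mem[].
have ch : chordless G c.
  move=> x y xc yc; rewrite edge ?cS //= => /orP[//|/hasP[c2 c2cs /cycle_edges_mem[]]].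
  by move/(csN _ _ c2cs); rewrite xc.
rewrite !split // IHH gc // -/C doubleS; lia.
Qed.

Lemma delta_reachable_rk S : delta_reachable G S ->
  exists m, forall w, weighting G w -> rk w [set: T] = (rk w S + m.*2)%N.
Proof.
elim=> [|{}S u v _ [m IH] uS vS du uv]; first by exists 0%N => w _; rewrite addn0.
exists m.+1 => w ww; rewrite IH // (rk_delta ww uS vS du uv) doubleS; lia.
Qed.

End Decomposition.

(** * Rank of an even cycle *)

Section CycleRank.
Variables (F : fieldType) (T : finType) (G : sgraph T) (w : T -> T -> F) (eps : F).
Variables (ww : weighting G w) (eps2 : eps * eps = 1).
Variables (w_eps : forall x y, w y x = eps * w x y).
Variables (w_unit : forall x y, adj G x y -> w x y * w x y = 1).
Variables (x0 : T) (c' : seq T).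
Let c := x0 :: c'.
Variables (cc : is_cycle G c) (ch : chordless G c) (even_c : ~~ odd (size c)).

Let q := size c.
Let C := [set x in c].

(** The factor by which the entries of a kernel vector are multiplied after going
   once round the cycle. Each of the q/2 steps of length two moves the entry past
   two edges and contributes a factor - eps. *)
Definition holonomy := (- eps) ^+ q./2 * \prod_(x <- c) w x (next c x).

Let vtx i := nth x0 c (i %% q).

Let un : uniq c. Proof. by case/andP: cc => _ /andP[]. Qed.
Let q2 : (2 < q)%N. Proof. by case/andP: cc. Qed.
Let q0 : (0 < q)%N. Proof. exact: leq_trans q2. Qed.

Let vtx_in i : vtx i \in c.
Proof. by rewrite /vtx mem_nth // ltn_pmod. Qed.

Let vtx_period i : vtx (i + q) = vtx i.
Proof. by rewrite /vtx modnDr. Qed.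

Let vtx_eq i j : (vtx i == vtx j) = (i == j %[mod q]).
Proof. by rewrite /vtx nth_uniq // ltn_pmod. Qed.

Let vtx_index x : x \in c -> x = vtx (index x c).
Proof. by move=> xc; rewrite /vtx modn_small ?index_mem // nth_index. Qed.

Let next_vtx i : next c (vtx i) = vtx i.+1.
Proof.
rewrite next_nth vtx_in /vtx index_uniq ?ltn_pmod //.
have lt : (i %% q < q)%N by rewrite ltn_pmod.
rewrite -[in RHS]addn1 -modnDml addn1.
have [E|N] := eqVneq (i %% q).+1 q; last first.
  have lt' : ((i %% q).+1 < q)%N by rewrite ltn_neqAle N.
  by rewrite (modn_small lt').
rewrite E modnn nth_default //=; rewrite -ltnS; rewrite E.
by [].
Qed.

Let adj_vtx i : adj G (vtx i) (vtx i.+1).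
Proof.
by rewrite -next_vtx; case/andP: cc => _ /andP[cy _]; apply: next_cycle.
Qed.

Let vtx_nbr i y : y \in c -> adj G (vtx i.+1) y -> y = vtx i \/ y = vtx i.+2.
Proof.
move=> yc a; case: (cycle_edgesP (ch (vtx_in _) yc a)) => -[_ E].
  by right; rewrite E next_vtx.
left; rewrite (vtx_index yc) next_vtx in E.
apply/eqP; rewrite (vtx_index yc) vtx_eq -(eqn_modDr 1) !addn1 -vtx_eq.
by rewrite -E.
Qed.

Let vtx_neq2 i : vtx i != vtx i.+2.
Proof.
rewrite vtx_eq -[X in X == _ %[mod _]]addn0 -addn2 eqn_modDl.
by rewrite !modn_small.
Qed.

Let mul_wmx (u : 'rV[F]_#|T|) i :
  (u *m wmx w C) 0 (enum_rank (vtx i.+1)) =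
  u 0 (enum_rank (vtx i)) * w (vtx i) (vtx i.+1) +
  u 0 (enum_rank (vtx i.+2)) * w (vtx i.+2) (vtx i.+1).
Proof.
have inC j : vtx j \in C by rewrite inE vtx_in.
rewrite mxE (bigD1 (enum_rank (vtx i))) //= (bigD1 (enum_rank (vtx i.+2))) /=; last first.
  by rewrite (inj_eq enum_rank_inj) eq_sym vtx_neq2.
rewrite !mxE !enum_rankK !inC /= big1 ?addr0 // => k /andP[k1 k2].
rewrite mxE enum_rankK; case: ifP => [/andP[kC _]|]; rewrite ?mulr0 //.
rewrite (weighting0 ww) ?mulr0 // adj_sym; apply/negP => a.
have kc : enum_val k \in c by rewrite inE in kC.
by case: (vtx_nbr kc a) => E; move: k1 k2; rewrite -E enum_valK eqxx.
Qed.

Let W i := w (vtx i) (vtx i.+1).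

Let WW i : W i * W i = 1.
Proof. exact: w_unit. Qed.

(** The value at the i-th vertex of a kernel vector is forced by its value two
   steps before; phi accumulates these factors along the cycle, whose total is
   the holonomy. *)
Let phi i := (- eps) ^+ i./2 * \prod_(0 <= j < i) W j.

Let phi_rec i : phi i.+2 = - eps * W i * W i.+1 * phi i.
Proof. by rewrite /phi /= !big_nat_recr //= exprS; ring. Qed.

Let holonomyE : holonomy = phi q.
Proof.
rewrite /holonomy /phi; congr (_ * _); rewrite (big_nth x0).
apply: eq_big_nat => i /andP[_ lt].
have E : nth x0 c i = vtx i by rewrite /vtx modn_small.
by rewrite E next_vtx.
Qed.

Let phi_period i : phi (i + q) = holonomy * phi i.
Proof.
suff [] : phi (i + q) = holonomy * phi i /\ phi (i.+1 + q) = holonomy * phi i.+1 by [].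
have Wq j : W (j + q) = W j by rewrite /W -addSn !vtx_period.
elim: i => [|i [IH1 IH2]].
  have phi0 : phi 0 = 1 by rewrite /phi big_geq // mulr1.
  rewrite holonomyE phi0 mulr1 add0n; split=> //.
  rewrite add1n /phi big_nat_recr //= big_nat1 -[q in W q]add0n Wq mulrA.
  have o : odd (size c') by move: even_c; rewrite /= negbK.
  by rewrite uphalf_half o add1n mulr1 mulrA.
split=> //; rewrite addSn addSn !phi_rec -addSn IH1 !Wq; ring.
Qed.

Let phi_neq0 i : phi i != 0.
Proof.
have en : eps != 0 by apply: contra_eq_neq eps2 => ->; rewrite mulr0 eq_sym oner_neq0.
rewrite mulf_neq0 ?expf_neq0 ?oppr_eq0 // prodf_seq_neq0; apply/allP => j _ /=.
by apply: contra_eq_neq (WW j) => ->; rewrite mulr0 eq_sym oner_neq0.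
Qed.

Let kerE (u : 'rV[F]_#|T|) i :
  ((u *m wmx w C) 0 (enum_rank (vtx i.+1)) == 0) =
  (u 0 (enum_rank (vtx i.+2)) == - eps * W i * W i.+1 * u 0 (enum_rank (vtx i))).
Proof.
rewrite mul_wmx (w_eps (vtx i.+1) (vtx i.+2)) -/(W _) -/(W _).
set s := u 0 (enum_rank (vtx i)); set t := u 0 (enum_rank (vtx i.+2)).
have -> : s * W i + t * (eps * W i.+1) =
          eps * W i.+1 * (t - (- eps * W i * W i.+1 * s)).
  have -> : eps * W i.+1 * (t - - eps * W i * W i.+1 * s) =
    t * (eps * W i.+1) + (eps * eps) * (W i.+1 * W i.+1) * (W i * s) by ring.
  by rewrite eps2 WW; ring.
have N : eps * W i.+1 != 0.
  have E : (eps * W i.+1) * (eps * W i.+1) = 1.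
    by rewrite mulrACA eps2 WW mulr1.
  by apply: contra_eq_neq E => ->; rewrite mulr0 eq_sym oner_neq0.
by rewrite mulf_eq0 (negbTE N) subr_eq0.
Qed.

(** Adding the identity outside of the cycle turns invertibility of the block of the
   cycle into invertibility of the whole matrix. *)
Lemma cycle_rk_full : holonomy != 1 -> rk w C = q.
Proof.
move=> pi1; have cardC : #|C| = q by rewrite cardsE (card_uniqP un).
apply/eqP; rewrite eqn_leq -{1}cardC rk_leq_card /=.
have free : row_free (wmx w C + proj_mx F (~: C)).
  apply: inj_row_free => u; rewrite mulmxDr => uM.
  have outC x : x \notin C -> u 0 (enum_rank x) = 0.
    move=> xC; have := congr1 (fun M : 'rV_#|T| => M 0 (enum_rank x)) uM.
    rewrite [LHS]mxE mul_projE enum_rankK inE xC [X in X + _]mxE big1 ?add0r ?mxE //.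
    by move=> k _; rewrite !mxE enum_rankK (negbTE xC) andbF mulr0.
  have inC i : u 0 (enum_rank (vtx i)) = 0.
    have step j : u 0 (enum_rank (vtx j.+2)) = - eps * W j * W j.+1 * u 0 (enum_rank (vtx j)).
      apply/eqP; rewrite -kerE.
      have := congr1 (fun M : 'rV_#|T| => M 0 (enum_rank (vtx j.+1))) uM.
      have vC : vtx j.+1 \in C by rewrite inE vtx_in.
      by rewrite [LHS]mxE mul_projE enum_rankK in_setC vC addr0 => ->; rewrite mxE.
    have iter k : u 0 (enum_rank (vtx (i + k.*2))) * phi i =
                  phi (i + k.*2) * u 0 (enum_rank (vtx i)).
      elim: k => [|k IH]; first by rewrite addn0 mulrC.
      by rewrite doubleS !addnS step phi_rec -[LHS]mulrA IH mulrA.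
    have := iter q./2; rewrite even_halfK // vtx_period phi_period => E.
    have : (1 - holonomy) * phi i * u 0 (enum_rank (vtx i)) = 0.
      by rewrite !mulrBl -E; ring.
    have N : (1 - holonomy) * phi i != 0.
      by rewrite mulf_neq0 ?phi_neq0 // subr_eq0 eq_sym.
    by move/eqP; rewrite mulf_eq0 (negbTE N) => /eqP.
  apply/rowP => k; rewrite [RHS]mxE -[k]enum_valK.
  case: (boolP (enum_val k \in C)) => [|/outC//].
  by rewrite inE => /vtx_index ->.
have := mxrank_add (wmx w C) (proj_mx F (~: C)).
rewrite (eqP free) => le1; have le2 := rank_proj_mx F (~: C).
have := cardsC C; rewrite cardC -/(rk w C) => E.
move: le1; rewrite -/(rk w C); lia.
Qed.

(** With trivial holonomy, phi restricted to the vertices of even index, or to those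
   of odd index, is a kernel vector; these two relations express the rows of the
   first two vertices through the other ones. *)
Lemma cycle_rk_defect : holonomy = 1 -> (rk w C <= q - 2)%N.
Proof.
move=> pi1; pose C' := C :\: [set vtx 0; vtx 1].
have cardC : #|C| = q by rewrite cardsE (card_uniqP un).
have v01 : vtx 0 != vtx 1 by rewrite vtx_eq !modn_small // (ltn_trans _ q2).
have cardC' : #|C'| = (q - 2)%N.
  rewrite cardsD (setIidPr _) ?cards2 ?v01 ?cardC //.
  by apply/subsetP => x; rewrite !inE => /orP[]/eqP->; apply: vtx_in.
rewrite -cardC'; apply: leq_trans (rank_proj_mx F C').
apply: leq_trans (mxrankM_maxl _ (wmx w C)); apply: mxrankS.
have inC' x : (x \in C') = [&& x != vtx 0, x != vtx 1 & x \in c].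
  by rewrite in_setD in_set2 negb_or in_set andbA.
have phi_mod i : phi (i %% q) = phi i.
  rewrite {2}(divn_eq i q); elim: (i %/ q)%N => [|k IH] //=.
  by rewrite mulSn -addnA addnC phi_period pi1 mul1r.
(* The vector u s is supported on the vertices whose index has parity s. *)
pose u (s : bool) : 'rV[F]_#|T| :=
  \row_k (if (enum_val k \in c) && (odd (index (enum_val k) c) == s)
          then phi (index (enum_val k) c) else 0).
have uE s i : u s 0 (enum_rank (vtx i)) = if odd i == s then phi i else 0.
  rewrite mxE enum_rankK vtx_in andTb /vtx index_uniq ?ltn_pmod // phi_mod.
  suff -> : odd (i %% q) = odd i by [].
  by rewrite [in RHS](divn_eq i q) oddD oddM (negbTE even_c) andbF.
have uker s : u s *m wmx w C = 0.
  apply/rowP => k; rewrite [RHS]mxE -[k]enum_valK.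
  case: (boolP (enum_val k \in c)) => kc; last first.
    have kC : (enum_val k \in C) = false by rewrite inE (negbTE kc).
    by rewrite mxE big1 // => j _; rewrite !mxE enum_rankK kC andbF mulr0.
  rewrite (vtx_index kc) -vtx_period -[q]prednK // addnS.
  apply/eqP; rewrite kerE !uE /= negbK phi_rec.
  by case: ifP => _; rewrite ?mulr0.
have rows (s : bool) :
    (row (enum_rank (vtx s)) (wmx w C) <= proj_mx F C' *m wmx w C)%MS.
  have dec : u s = u s *m proj_mx F C' + phi s *: delta_mx 0 (enum_rank (vtx s)).
    apply/rowP => k; rewrite -[k]enum_valK; set x := enum_val k.
    rewrite [RHS]mxE mul_projE enum_rankK inC' [X in _ + X]mxE [X in phi s * X]mxE.
    rewrite eqxx (inj_eq enum_rank_inj) /=.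
    have [->|x0'] := eqVneq x (vtx 0).
      by rewrite uE /=; case: (s); rewrite ?(negbTE v01) ?eqxx /= ?mulr0 ?mulr1 ?addr0 ?add0r.
    have [->|x1] := eqVneq x (vtx 1).
      by rewrite uE /=; case: (s); rewrite ?eqxx ?(eq_sym (vtx 1)) ?(negbTE v01) /= ?mulr0 ?mulr1 ?addr0 ?add0r.
    have -> : (x == vtx s) = false by case: (s); apply: negbTE.
    rewrite mulr0 addr0 /=; case: (boolP (x \in c)) => // xc.
    by rewrite mxE enum_rankK (negbTE xc).
  have : u s *m proj_mx F C' *m wmx w C = - phi s *: row (enum_rank (vtx s)) (wmx w C).
    have := uker s; rewrite {1}dec mulmxDl -scalemxAl -rowE => /eqP.
    by rewrite addr_eq0 => /eqP ->; rewrite scaleNr.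
  move/(congr1 (fun v => (- phi s)^-1 *: v)); rewrite scalerA mulVf ?oppr_eq0 // scale1r => <-.
  by rewrite -mulmxA scalemx_sub // submxMl.
apply/row_subP => k; rewrite -[k]enum_valK.
case: (boolP (enum_val k \in C')) => kC.
  suff -> : row (enum_rank (enum_val k)) (wmx w C) =
    row (enum_rank (enum_val k)) (proj_mx F C' *m wmx w C) by apply: row_sub.
  by apply/rowP => j; rewrite [RHS]mxE proj_mulE enum_rankK kC mxE.
have [kc|kc] := boolP (enum_val k \in c); last first.
  suff -> : row (enum_rank (enum_val k)) (wmx w C) = 0 by apply: sub0mx.
  have kC0 : (enum_val k \in C) = false by rewrite inE (negbTE kc).
  by apply/rowP => j; rewrite !mxE enum_rankK kC0.
move: kC; rewrite inC' kc andbT negb_and !negbK => /orP[]/eqP->; [exact: (rows false) | exact: (rows true)].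
Qed.

End CycleRank.

(** * Adjacency and skew-adjacency matrices *)

Section OrientedGraphs.
Variables (R : realType) (T : finType) (D : ograph T).

Let G := underlying D.

Definition adj_weight : T -> T -> R := fun x y => (adj G x y)%:R.

Notation a := adj_weight.
Notation b := (skew_entry R D).

Lemma adj_weighting : weighting G a.
Proof. by move=> x y; rewrite /a pnatr_eq0 eqb0 negbK. Qed.

Lemma skew_weighting : weighting G b.
Proof.
move=> x y; rewrite /skew_entry /G /= /underlying_rel.
case: (D x y); first by rewrite oner_neq0.
by case: (D y x); rewrite ?oppr_eq0 ?oner_neq0 ?eqxx.
Qed.

Lemma skew_entryN x y : b y x = -1 * b x y.
Proof.
rewrite /skew_entry mulN1r; case xy: (D x y).
  by rewrite (negbTE (arc_asym xy)).
by case: (D y x); rewrite ?opprK ?oppr0.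
Qed.

Lemma skew_entry_sqr x y : adj G x y -> b x y * b x y = 1.
Proof.
rewrite -skew_weighting /skew_entry; case: ifP => _; first by rewrite mulr1.
by case: ifP; rewrite ?mulrNN ?mulr1 ?eqxx.
Qed.

Lemma graph_rankE : graph_rank R G = rk a [set: T].
Proof. by congr (\rank _); apply/matrixP => i j; rewrite !mxE !inE. Qed.

Lemma skew_rankE : skew_rank R D = rk b [set: T].
Proof. by congr (\rank _); apply/matrixP => i j; rewrite !mxE !inE. Qed.

Lemma lower_optimalE : lower_optimal R D <-> tight G a b [set: T].
Proof.
rewrite /lower_optimal /tight -/G graph_rankE skew_rankE.
have -> : cycle_space_dim G = dim_in G [set: T].
  by apply: eq_rel_dim => x y; rewrite /adj_in !inE.
by split; lia.
Qed.

Lemma rank_gap2_cycle c : is_cycle G c -> chordless G c ->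
  rank_gap2 a b c <-> evenly_oriented R D c /\ size c = 2 %[mod 4].
Proof.
move=> cc ch; have awt := adj_weighting; have bwt := skew_weighting.
have /andP[_ upa] := cycle_rk_bounds awt cc ch.
have /andP[lob _] := cycle_rk_bounds bwt cc ch.
have even_gap := rank_gap2_even awt bwt cc ch.
case: c cc ch upa lob even_gap => [|x0 c'] // cc ch upa lob even_gap; set c := x0 :: c' in cc ch upa lob even_gap *.
have [odd_c|even_c] := boolP (odd (size c)).
  by split=> [/even_gap|[[]]]; rewrite odd_c.
have a_sym x y : a y x = 1 * a x y by rewrite mul1r /a adj_sym.
have a_sqr x y : adj G x y -> a x y * a x y = 1 by rewrite /a => ->; rewrite mulr1.
have nn1 : -1 * -1 = 1 :> R by rewrite mulrNN mulr1.
have afull := cycle_rk_full awt (mulr1 1) a_sym a_sqr cc ch even_c.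
have adef := cycle_rk_defect awt (mulr1 1) a_sym a_sqr cc ch even_c.
have bfull := cycle_rk_full bwt nn1 skew_entryN skew_entry_sqr cc ch even_c.
have bdef := cycle_rk_defect bwt nn1 skew_entryN skew_entry_sqr cc ch even_c.
have nextG x : x \in c -> adj G x (next c x).
  by case/andP: cc => _ /andP[cy _]; apply: next_cycle.
have ha : holonomy a 1 x0 c' = (-1) ^+ (size c)./2.
  rewrite /holonomy big_seq big1 ?mulr1 // => x xc.
  by rewrite /a nextG.
set P := \prod_(x <- c) b x (next c x).
have hb : holonomy b (-1) x0 c' = P by rewrite /holonomy opprK expr1n mul1r.
have PP : P * P = 1.
  rewrite -big_split big_seq big1 // => x xc; apply: skew_entry_sqr; exact: nextG.
rewrite ha -/c in afull adef; rewrite hb -/c in bfull bdef.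
have sz : (2 < size c)%N by case/andP: cc.
have P1 : (0 < P) = (P == 1).
  have /orP[/eqP->|/eqP->] : (P == 1) || (P == -1) by rewrite -eqf_sqr expr1n expr2 PP.
    by rewrite ltr01 eqxx.
  by rewrite oppr_gt0 ltr10 eq_sym -subr_eq0 opprK -(natrD _ 1 1) pnatr_eq0.
have mod4 : (size c = 2 %[mod 4]) <-> odd (size c)./2.
  rewrite -[size c]odd_double_half (negbTE even_c) add0n doubleK.
  by split; lia.
have {}lob : (size c - 2 <= rk b [set x in c])%N.
  apply: leq_trans lob; rewrite -[in X in (X <= _)%N](odd_double_half (size c)).
  rewrite (negbTE even_c) add0n -[in X in (_ <= X)%N](odd_double_half (size c)) (negbTE even_c) add0n.
  lia.
rewrite mod4 /rank_gap2 /evenly_oriented -/P P1.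
case: (boolP (odd (size c)./2)) => oh.
  move: afull; rewrite -signr_odd oh expr1 => /(_ _) -> //; last first.
    by rewrite eq_sym -subr_eq0 opprK -(natrD _ 1 1) pnatr_eq0.
  split=> [szE|[[_ /eqP P1'] _]]; last by have := bdef P1'; lia.
  do 2!split=> //; apply/negPn/negP => /bfull E; move: szE; rewrite E; lia.
split=> [gE|[_] //].
have := adef; rewrite -signr_odd (negbTE oh) => /(_ erefl); rewrite gE; move: lob sz; lia.
Qed.

End OrientedGraphs.

Theorem theorem1p3 (R : realType) (T : finType) (D : ograph T) :
  lower_optimal R D <->
  [/\ cycles_vertex_disjoint (underlying D),
      forall c : seq T, is_cycle (underlying D) c ->
        evenly_oriented R D c /\ size c = 2 %[mod 4] &
      exists (S : {set T}) (k : nat),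
        [/\ delta_reachable (underlying D) S,
            k%:Z = cycle_space_dim (underlying D) &
            cycles_and_isolated (underlying D) S k]].
Proof.
have awt := adj_weighting R D; have bwt := skew_weighting R D.
have cT (c : seq T) : {subset c <= [set: T]} by move=> x _; rewrite inE.
rewrite lower_optimalE; split=> [tG | [_ even2 [S [k [rS kE ci]]]]].
  have [[m [S [k [d kE ci]]]] gaps] := tight_structured awt bwt tG.
  split.
  - by move=> c1 c2 cc1 cc2; apply: (tight_cycles_disjoint awt bwt tG).
  - move=> c cc; apply/rank_gap2_cycle => //; last exact: gaps.
    exact: (tight_chordless awt bwt tG cc (cT c)).
  exists S, k; split=> //; first by apply: deltas_reachable d _; constructor.
  by rewrite kE; apply/esym/eq_rel_dim => x y; rewrite /adj_in !inE.
have [m rkT] := delta_reachable_rk R rS.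
have gS : rk (adj_weight R D) S = (rk (skew_entry R D) S + k.*2)%N.
  by apply: rank_gap_cycles_and_isolated ci _ => // c cc ch; apply/rank_gap2_cycle => //; apply: even2.
have dk : dim_in (underlying D) [set: T] = k.
  by rewrite kE; apply: eq_rel_dim => x y; rewrite /adj_in !inE.
rewrite /tight (rkT _ awt) (rkT _ bwt) gS dk; lia.
Qed.
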